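(* Let $K$ be a field. Then the group $L_K(R_2)^\times$ is finitely generated if and only if $K$ is finite.
   Context: $L_K(R_2)$ is the unital associative $K$-algebra generated by $e,f,e^*,f^*$ subject to $e^*e=f^*f=1$, $e^*f=f^*e=0$, $ee^*+ff^*=1$. For a ring $R$, $R^\times$ denotes its unit group. *)

(* Defs.v *)
From HB Require Import structures.
From mathcomp Require Import all_boot all_order all_algebra.
From mathcomp Require Import finmap.
From mathcomp.multinomials Require Import monalg.
From mathcomp Require Import boolp classical_sets functions cardinality.

Set Implicit Arguments.
Unset Strict Implicit.
Unset Printing Implicit Defensive.

Import GRing.Theory.

Local Open Scope classical_set_scope.
Local Open Scope quotient_scope.
Local Open Scope ring_scope.

Section FinitelyGenerated.
Variable G : groupType.
Local Open Scope group_scope.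

Definition is_subgroup (H : set G) : Prop :=
  H 1 /\ forall x y, H x -> H y -> H (x * y^-1).

Definition generated_subgroup (A : set G) : set G := smallest is_subgroup A.

Definition finitely_generated : Prop :=
  exists A : set G, finite_set A /\ generated_subgroup A = setT.

End FinitelyGenerated.

(* The library's {unit R} is restricted to finite rings. *)
Section UnitGroup.
Variable R : unitRingType.

Inductive unit_group : predArgType := UnitGroup (x : R) of x \is a GRing.unit.

Definition unit_group_val (u : unit_group) := let: UnitGroup x _ := u in x.

HB.instance Definition _ := [isSub for unit_group_val].
HB.instance Definition _ := [Choice of unit_group by <:].

Implicit Types u v : unit_group.

Fact unit_group_inv_subproof u : (val u)^-1 \is a GRing.unit.
Proof. by rewrite unitrV (valP u). Qed.

Fact unit_group_mul_subproof u v : val u * val v \is a GRing.unit.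
Proof. by rewrite (unitrMr _ (valP u)) (valP v). Qed.

Definition unit_group_one := UnitGroup (unitr1 R).
Definition unit_group_inv u := UnitGroup (unit_group_inv_subproof u).
Definition unit_group_mul u v := UnitGroup (unit_group_mul_subproof u v).

Fact unit_group_mulA : associative unit_group_mul.
Proof. by move=> u v w; apply/val_inj/mulrA. Qed.

Fact unit_group_mul1 : left_id unit_group_one unit_group_mul.
Proof. by move=> u; apply/val_inj/mul1r. Qed.

Fact unit_group_mulr1 : right_id unit_group_one unit_group_mul.
Proof. by move=> u; apply/val_inj/mulr1. Qed.

Fact unit_group_mulV :
  left_inverse unit_group_one unit_group_inv unit_group_mul.
Proof. by move=> u; apply/val_inj/(mulVr (valP u)). Qed.

Fact unit_group_mulrV :
  right_inverse unit_group_one unit_group_inv unit_group_mul.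
Proof. by move=> u; apply/val_inj/(mulrV (valP u)). Qed.

HB.instance Definition _ := isGroup.Build unit_group unit_group_mulA
  unit_group_mul1 unit_group_mulr1 unit_group_mulV unit_group_mulrV.

End UnitGroup.

Definition two_sided_ideal (R : pzRingType) (J : set R) : Prop :=
  [/\ J 0, forall x y, J x -> J y -> J (x - y)
    & forall a x b, J x -> J (a * x * b)].

(* Properness is needed because the library's algebras are nonzero rings; the
   quotients of mathcomp.algebra.ring_quotient are restricted to commutative
   rings. *)
Record proper_two_sided_ideal (R : pzRingType) := ProperTwoSidedIdeal {
  ideal_set :> R -> Prop;
  ideal_setP : two_sided_ideal ideal_set;
  ideal_set1 : ~ ideal_set 1
}.

Section QuotientAlgebra.
Variables (K : comNzRingType) (A : algType K) (J : proper_two_sided_ideal A).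

Definition ideal_pred : pred A := fun x => `[< J x >].

Fact ideal_pred_zmod_closed : zmod_closed ideal_pred.
Proof.
have [J0 JB _] := ideal_setP J.
split=> [|x y /asboolP Jx /asboolP Jy]; apply/asboolP => //; exact: JB.
Qed.

HB.instance Definition _ :=
  GRing.isZmodClosed.Build A ideal_pred ideal_pred_zmod_closed.

Definition quot_zmod := Quotient.quot (GRing.ZmodClosed.clone A ideal_pred _).

Definition quot_alg : Type := quot_zmod.

HB.instance Definition _ := Quotient.on quot_zmod.
HB.instance Definition _ := GRing.Zmodule.on quot_zmod.
HB.instance Definition _ := GRing.Zmodule.on quot_alg.

(* The operations are locked so that unification does not unfold them down to
   those of A. *)
Definition to_quot : A -> quot_alg := locked (fun x => \pi_quot_zmod x).

Definition of_quot (x : quot_alg) : A := repr (x : quot_zmod).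

Lemma of_quotK : cancel of_quot to_quot.
Proof. by move=> x; rewrite /to_quot -lock; apply: reprK. Qed.

Lemma to_quotP x y : to_quot x = to_quot y <-> J (x - y).
Proof.
rewrite /to_quot -lock; split=> [/eqP|Jxy].
  by rewrite -Quotient.idealrBE => /asboolP.
by apply/eqP; rewrite -Quotient.idealrBE; apply/asboolP.
Qed.

Lemma of_to_quot x : J (of_quot (to_quot x) - x).
Proof. by apply/to_quotP; rewrite of_quotK. Qed.

Fact to_quot_zmod_morphism : zmod_morphism to_quot.
Proof. by move=> x y; rewrite /to_quot -lock raddfB. Qed.

HB.instance Definition _ :=
  GRing.isZmodMorphism.Build A quot_alg to_quot to_quot_zmod_morphism.

Definition quot_one : quot_alg := locked (to_quot 1).
Definition quot_mul : quot_alg -> quot_alg -> quot_alg :=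
  locked (fun x y => to_quot (of_quot x * of_quot y)).
Definition quot_scale : K -> quot_alg -> quot_alg :=
  locked (fun a x => to_quot (a *: of_quot x)).

Lemma quot_oneE : quot_one = to_quot 1.
Proof. by rewrite /quot_one -lock. Qed.

Lemma ideal_setM a x b : J x -> J (a * x * b).
Proof. by case: (ideal_setP J) => _ _; apply. Qed.

Lemma ideal_setD x y : J x -> J y -> J (x + y).
Proof.
have [J0 JB _] := ideal_setP J => Jx Jy.
by rewrite -[y]opprK -[- y]sub0r; apply: JB Jx (JB _ _ J0 Jy).
Qed.

Lemma quot_mulE x y : quot_mul (to_quot x) (to_quot y) = to_quot (x * y).
Proof.
rewrite /quot_mul -lock; apply/to_quotP; set x' := of_quot _; set y' := of_quot _.
have -> : x' * y' - x * y = 1 * (x' - x) * y' + x * (y' - y) * 1.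
  by rewrite mul1r mulr1 mulrBl mulrBr addrA subrK.
by apply: ideal_setD; apply: ideal_setM; apply: of_to_quot.
Qed.

Lemma quot_scaleE a x : quot_scale a (to_quot x) = to_quot (a *: x).
Proof.
rewrite /quot_scale -lock; apply/to_quotP; rewrite -scalerBr -[_ - x]mulr1 -[_ * 1]mul1r mulrA scalerAl.
by rewrite scalerAl; apply: ideal_setM; apply: of_to_quot.
Qed.

Fact quot_mulA : associative quot_mul.
Proof.
by move=> x y z; rewrite -[x]of_quotK -[y]of_quotK -[z]of_quotK !quot_mulE mulrA.
Qed.

Fact quot_mul1 : left_id quot_one quot_mul.
Proof. by move=> x; rewrite -[x]of_quotK quot_oneE quot_mulE mul1r. Qed.

Fact quot_mulr1 : right_id quot_one quot_mul.
Proof. by move=> x; rewrite -[x]of_quotK quot_oneE quot_mulE mulr1. Qed.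

Fact quot_mulDl : left_distributive quot_mul +%R.
Proof.
move=> x y z; rewrite -[x]of_quotK -[y]of_quotK -[z]of_quotK.
by rewrite -raddfD !quot_mulE -raddfD mulrDl.
Qed.

Fact quot_mulDr : right_distributive quot_mul +%R.
Proof.
move=> x y z; rewrite -[x]of_quotK -[y]of_quotK -[z]of_quotK.
by rewrite -raddfD !quot_mulE -raddfD mulrDr.
Qed.

Fact quot_one_neq0 : quot_one != 0.
Proof.
rewrite quot_oneE -(raddf0 to_quot); apply/eqP => /to_quotP; rewrite subr0.
exact: ideal_set1.
Qed.

HB.instance Definition _ := GRing.Zmodule_isNzRing.Build quot_alg
  quot_mulA quot_mul1 quot_mulr1 quot_mulDl quot_mulDr quot_one_neq0.

Fact quot_scaleA a b x : quot_scale a (quot_scale b x) = quot_scale (a * b) x.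
Proof. by rewrite -[x]of_quotK !quot_scaleE scalerA. Qed.

Fact quot_scale1 : left_id 1 quot_scale.
Proof. by move=> x; rewrite -[x]of_quotK quot_scaleE scale1r. Qed.

Fact quot_scaleDr : right_distributive quot_scale +%R.
Proof.
move=> a x y; rewrite -[x]of_quotK -[y]of_quotK.
by rewrite -raddfD !quot_scaleE -raddfD scalerDr.
Qed.

Fact quot_scaleDl x : {morph quot_scale^~ x : a b / a + b}.
Proof. by move=> a b; rewrite -[x]of_quotK !quot_scaleE -raddfD scalerDl. Qed.

HB.instance Definition _ := GRing.Zmodule_isLmodule.Build K quot_alg
  quot_scaleA quot_scale1 quot_scaleDr quot_scaleDl.

Fact to_quot_monoid_morphism : monoid_morphism to_quot.
Proof. by split=> [|x y]; rewrite -?quot_oneE -?quot_mulE. Qed.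

HB.instance Definition _ :=
  GRing.isMonoidMorphism.Build A quot_alg to_quot to_quot_monoid_morphism.

Fact to_quot_scalable : scalable to_quot.
Proof. by move=> a x; rewrite -quot_scaleE. Qed.

HB.instance Definition _ :=
  GRing.isScalable.Build K A quot_alg *:%R to_quot to_quot_scalable.

Fact quot_scaleAl (a : K) (x y : quot_alg) : a *: (x * y) = a *: x * y.
Proof.
rewrite -[x]of_quotK -[y]of_quotK.
by rewrite -rmorphM -!linearZ -rmorphM /= scalerAl.
Qed.

HB.instance Definition _ :=
  GRing.Lmodule_isLalgebra.Build K quot_alg quot_scaleAl.

Fact quot_scaleAr (a : K) (x y : quot_alg) : a *: (x * y) = x * (a *: y).
Proof.
rewrite -[x]of_quotK -[y]of_quotK.
by rewrite -rmorphM -!linearZ -rmorphM /= scalerAr.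
Qed.

HB.instance Definition _ :=
  GRing.Lalgebra_isAlgebra.Build K quot_alg quot_scaleAr.

Definition quot_unit : pred quot_alg :=
  fun x => `[< exists y, y * x = 1 /\ x * y = 1 >].

Definition quot_inv (x : quot_alg) : quot_alg :=
  xget x [set y | y * x = 1 /\ x * y = 1].

Lemma quot_invP x : quot_unit x -> quot_inv x * x = 1 /\ x * quot_inv x = 1.
Proof. by case/asboolP => y yP; rewrite /quot_inv; case: xgetP => // /(_ y). Qed.

Fact quot_mulVr : {in quot_unit, left_inverse 1 quot_inv *%R}.
Proof. by move=> x /quot_invP[]. Qed.

Fact quot_mulrV : {in quot_unit, right_inverse 1 quot_inv *%R}.
Proof. by move=> x /quot_invP[]. Qed.

Fact quot_unitP x y : y * x = 1 /\ x * y = 1 -> quot_unit x.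
Proof. by move=> xy; apply/asboolP; exists y. Qed.

Fact quot_invr_out : {in [predC quot_unit], quot_inv =1 id}.
Proof.
move=> x; rewrite inE /= => /negP xU; rewrite /quot_inv.
by case: xgetP => // y _ xy; case: xU; apply: quot_unitP xy.
Qed.

HB.instance Definition _ := GRing.NzRing_hasMulInverse.Build quot_alg
  quot_mulVr quot_mulrV quot_unitP quot_invr_out.

End QuotientAlgebra.

Section MonoidAlgebra.
Variables (M : monomType) (K : comNzRingType).

Lemma malg_scalerAr (a : K) (x y : {malg K[M]}) : a *: (x * y) = x * (a *: y).
Proof.
have comm_a z : GRing.comm (malgC a) z.
  rewrite /GRing.comm !malgM_def fgmulUg fgmulgU; apply: eq_bigr => k _.
  by rewrite mul1m mulm1 mulrC.
by rewrite -!mul_malgC !mulrA comm_a.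
Qed.

Variables (T : Type) (act : M -> (T -> K) -> T -> K).

Definition malg_act (x : {malg K[M]}) (v : T -> K) (t : T) : K :=
  mmap idfun (fun k => act k v t) x.

Lemma malg_actB x y v t : malg_act (x - y) v t = malg_act x v t - malg_act y v t.
Proof. exact: mmapB. Qed.

Lemma malg_actD x y v t : malg_act (x + y) v t = malg_act x v t + malg_act y v t.
Proof. exact: mmapD. Qed.

Lemma malg_actE x v t :
  malg_act x v t = \sum_(k <- msupp x) x@_k * act k v t.
Proof. by []. Qed.

Lemma malg_act_sum I (r : seq I) (F : I -> {malg K[M]}) v t :
  malg_act (\sum_(i <- r) F i) v t = \sum_(i <- r) malg_act (F i) v t.
Proof. exact: raddf_sum. Qed.

Lemma malg_actU (c : K) k v t : malg_act << c *g k >> v t = c * act k v t.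
Proof. exact: mmapU. Qed.

Hypothesis act1 : forall v, act mone v = v.
Hypothesis actM : forall k l v, act (mmul k l) v = act k (act l v).
Hypothesis act_lin : forall k c u v,
  act k (fun t => c * u t + v t) = fun t => c * act k u t + act k v t.

Lemma malg_act1 v t : malg_act 1 v t = v t.
Proof. by rewrite malg_actU mul1r act1. Qed.

Lemma act0 k t : act k (fun=> 0) t = 0.
Proof.
have h := congr1 (@^~ t) (act_lin k (- 1) (fun=> 0) (fun=> 0)).
by rewrite /= mulr0 addr0 mulN1r addNr in h.
Qed.

Lemma malg_act0 x t : malg_act x (fun=> 0) t = 0.
Proof. by rewrite malg_actE big1 // => k _; rewrite act0 mulr0. Qed.

Lemma malg_actM x y v t : malg_act (x * y) v t = malg_act x (malg_act y v) t.
Proof.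
rewrite malgME malg_act_sum malg_actE; apply: eq_bigr => k _.
have -> : malg_act y v = fun s => \sum_(l <- msupp y) y@_l * act l v s.
  by apply/funext => s; rewrite malg_actE.
rewrite malg_act_sum; elim: (enum_fset (msupp y)) => [|l s IHs].
  rewrite big_nil (_ : (fun _ => _) = fun=> 0) ?act0 ?mulr0 //.
  by apply/funext => s; rewrite big_nil.
rewrite big_cons IHs malg_actU actM.
rewrite (_ : (fun s' => \sum_(j <- l :: s) _) = fun s' =>
    y@_l * act l v s' + \sum_(j <- s) y@_j * act j v s').
  by rewrite act_lin mulrDr mulrA.
by apply/funext => s'; rewrite big_cons.
Qed.

Lemma malg_act_rel x y z u v t :
  malg_act (x * y + z * u - 1) v t =
  malg_act x (malg_act y v) t + malg_act z (malg_act u v) t - v t.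
Proof. by rewrite malg_actB malg_actD !malg_actM malg_act1. Qed.

End MonoidAlgebra.

(* The free K-algebra on e, f, e*, f*. The letters are pairs of booleans: the
   first component tells f from e, the second marks the starred letters. *)
Definition free_alg (K : fieldType) : Type :=
  {malg K[{fmonom (bool * bool)%type}]}.

HB.instance Definition _ (K : fieldType) := GRing.Lalgebra.on (free_alg K).
HB.instance Definition _ (K : fieldType) :=
  GRing.Lalgebra_isAlgebra.Build K (free_alg K) (@malg_scalerAr _ K).

Lemma rmorph_rel (R S : nzRingType) (phi : {rmorphism R -> S}) x y z t :
  phi (x * y + z * t - 1) = phi x * phi y + phi z * phi t - 1.
Proof. by rewrite rmorphB rmorphD !rmorphM rmorph1. Qed.

Section LeavittAlgebra.
Variable K : fieldType.

Definition free_gen : bool -> bool -> free_alg K :=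
  locked (fun f star => << fmu (f, star) >>).

Local Notation e := (free_gen false false).
Local Notation e' := (free_gen false true).
Local Notation f := (free_gen true false).
Local Notation f' := (free_gen true true).

Inductive leavitt_rel : free_alg K -> Prop :=
| LeavittRel_e'e : leavitt_rel (e' * e - 1)
| LeavittRel_f'f : leavitt_rel (f' * f - 1)
| LeavittRel_e'f : leavitt_rel (e' * f)
| LeavittRel_f'e : leavitt_rel (f' * e)
| LeavittRel_sum : leavitt_rel (e * e' + f * f' - 1).

Definition leavitt_ideal : set (free_alg K) :=
  smallest (@two_sided_ideal (free_alg K)) leavitt_rel.

Fact leavitt_ideal_two_sided : two_sided_ideal leavitt_ideal.
Proof.
split=> [J [[J0 _ _] _] // | x y Jx Jy J JP | a x b Jx J JP].
  by case: (JP) => -[_ JB _] _; apply: JB; [apply: Jx | apply: Jy].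
by case: (JP) => -[_ _ JM] _; apply: JM; apply: Jx.
Qed.

(* The ideal is proper because the free algebra acts on the sequences
   v : nat -> K, with e and f inserting v at the even and at the odd places,
   and the relations act as zero. *)
Definition gen_act (i : bool * bool) (v : nat -> K) (n : nat) : K :=
  if i.2 then v (i.1 + n.*2)%N else if odd n == i.1 then v n./2 else 0.

Definition word_act (w : {fmonom (bool * bool)%type}) (v : nat -> K) :=
  foldr gen_act v w.

Lemma word_act1 v : word_act mone v = v.
Proof. by rewrite /word_act fm1. Qed.

Lemma word_actM w w' v : word_act (mmul w w') v = word_act w (word_act w' v).
Proof. by rewrite /word_act fmM foldr_cat. Qed.

Lemma word_act_lin w c u v :
  word_act w (fun n => c * u n + v n) =
  fun n => c * word_act w u n + word_act w v n.
Proof.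
rewrite /word_act; elim: (fmonom_val w) => //= i s ->.
apply/funext => n; rewrite /gen_act; case: (i.2) => //.
by case: ifP => _; rewrite ?mulr0 ?addr0.
Qed.

Definition free_act : free_alg K -> (nat -> K) -> nat -> K := malg_act word_act.

Lemma free_act_gen b s v : free_act (free_gen b s) v = gen_act (b, s) v.
Proof. by apply/funext => n; rewrite /free_act /free_gen -lock malg_actU mul1r /word_act fmU. Qed.

Lemma free_actB x y v n : free_act (x - y) v n = free_act x v n - free_act y v n.
Proof. exact: malg_actB. Qed.

Lemma free_actD x y v n : free_act (x + y) v n = free_act x v n + free_act y v n.
Proof. exact: malg_actD. Qed.

Lemma free_act1 v n : free_act 1 v n = v n.
Proof. exact: (malg_act1 word_act1). Qed.

Lemma free_actM x y v n : free_act (x * y) v n = free_act x (free_act y v) n.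
Proof. exact: (malg_actM word_actM word_act_lin). Qed.

Lemma free_act_rel x y z t v n :
  free_act (x * y + z * t - 1) v n =
  free_act x (free_act y v) n + free_act z (free_act t v) n - v n.
Proof. exact: (malg_act_rel word_act1 word_actM word_act_lin). Qed.

Lemma leavitt_ideal_act x v n : leavitt_ideal x -> free_act x v n = 0.
Proof.
pose J : set (free_alg K) := [set y | forall v n, free_act y v n = 0].
suff JP : two_sided_ideal J /\ leavitt_rel `<=` J by move=> /(_ _ JP); apply.
split.
  split=> [u m | y z Jy Jz u m | a y b Jy u m].
  - by rewrite -(subrr 1) free_actB subrr.
  - by rewrite free_actB Jy Jz subrr.
  - rewrite free_actM free_actM; have -> : free_act y (free_act b u) = fun=> 0.
      by apply/funext => k; apply: Jy.
    exact: (malg_act0 word_act_lin).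
move=> _ [] u m.
- rewrite free_actB free_act1 free_actM 2!free_act_gen /gen_act /=.
  by rewrite add0n odd_double doubleK subrr.
- rewrite free_actB free_act1 free_actM 2!free_act_gen /gen_act /=.
  by rewrite add0n odd_double uphalf_double subrr.
- by rewrite free_actM 2!free_act_gen /gen_act /= add0n odd_double.
- by rewrite free_actM 2!free_act_gen /gen_act /= add0n odd_double.
rewrite free_act_rel 4!free_act_gen /gen_act /=.
rewrite -[in X in _ - X](odd_double_half m).
by case: (odd m); rewrite /= ?add0r ?addr0 subrr.
Qed.

Fact leavitt_ideal1 : ~ leavitt_ideal 1.
Proof.
move=> /(leavitt_ideal_act (fun=> 1) 0); rewrite free_act1 => /eqP.
by rewrite oner_eq0.
Qed.

Definition leavitt_alg : unitAlgType K :=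
  quot_alg (ProperTwoSidedIdeal leavitt_ideal_two_sided leavitt_ideal1).

Definition leavitt_gen : bool -> bool -> leavitt_alg :=
  locked (fun f star => to_quot _ (free_gen f star)).

Lemma leavitt_genE b s : leavitt_gen b s = to_quot _ (free_gen b s).
Proof. by rewrite /leavitt_gen -lock. Qed.

Lemma leavitt_rel0 x : leavitt_rel x -> to_quot _ x = 0 :> leavitt_alg.
Proof.
move=> xR; rewrite -(raddf0 (to_quot _)); apply/to_quotP; rewrite subr0.
by move=> J [_]; apply.
Qed.

Lemma to_quot_rel1 (x y : free_alg K) :
  to_quot _ (x * y - 1) = to_quot _ x * to_quot _ y - 1 :> leavitt_alg.
Proof. by rewrite rmorphB rmorph1 rmorphM. Qed.

Local Notation E := (leavitt_gen false false).
Local Notation E' := (leavitt_gen false true).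
Local Notation F := (leavitt_gen true false).
Local Notation F' := (leavitt_gen true true).

Lemma leavitt_e'e : E' * E = 1.
Proof.
have := leavitt_rel0 LeavittRel_e'e.
by rewrite to_quot_rel1 -!leavitt_genE => /subr0_eq.
Qed.

Lemma leavitt_f'f : F' * F = 1.
Proof.
have := leavitt_rel0 LeavittRel_f'f.
by rewrite to_quot_rel1 -!leavitt_genE => /subr0_eq.
Qed.

Lemma leavitt_e'f : E' * F = 0.
Proof. by have := leavitt_rel0 LeavittRel_e'f; rewrite rmorphM /= -!leavitt_genE. Qed.

Lemma leavitt_f'e : F' * E = 0.
Proof. by have := leavitt_rel0 LeavittRel_f'e; rewrite rmorphM /= -!leavitt_genE. Qed.

Lemma leavitt_sum : E * E' + F * F' = 1.
Proof.
have := leavitt_rel0 LeavittRel_sum.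
by rewrite rmorph_rel /= -!leavitt_genE => /subr0_eq.
Qed.

End LeavittAlgebra.

(* Main.v *)
Require Import Defs.
From mathcomp Require Import all_boot all_order all_algebra.
From mathcomp Require Import boolp classical_sets functions cardinality.
From mathcomp Require Import perm finmap ring zify.
From mathcomp.multinomials Require Import monalg.

(* Finitely many units have their coefficients, and those of their inverses, in
   a finitely generated subring A of K.  The algebra acts on the sequences
   nat -> K, and the group generated by these units preserves the A-valued
   sequences.  If it contains all nonzero scalars, then A = K, and a field that
   is finitely generated as a ring is finite.

   Conversely, let H be generated by the transvections 1 + a_i r a_j^*, i != j,
   where a_i runs over the four paths of length two.  By the Steinberg relations
   finitely many of them suffice when K is finite, and every unit u lies in H:
   let P be the span of the paths in e and f.  If the a_i are all the paths of
   some large length, then both (a_i) and (u a_i) are invertible rows over P, so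
   it is enough that every such row w is of the form h c with h in H, where c is
   the row (e, fe, ffe, .., f^n) of the right length.  Write w = b A with b of
   this form and A over P.
   - If the constant term of A has a left kernel, a row of A can be replaced by
     one without constant term, e x + f y, and b_i by b_i e, b_i f and row i by
     x, y.
   - Otherwise the inverse of A has entries in P, and Cohn's weak algorithm
     lowers the degrees of the rows of A until A is constant.
   - A constant matrix is removed by Gauss-Jordan elimination; the dilations
     that occur are in H since those by c at e, f, fe and ff agree modulo H
     (Whitehead), while the one at f is the product of those at fe and ff. *)

Set Implicit Arguments.
Unset Strict Implicit.
Unset Printing Implicit Defensive.

Import Order.TTheory GRing.Theory Num.Theory.

Local Open Scope classical_set_scope.
Local Open Scope ring_scope.

(** * Integrality after clearing denominators *)

Section ScaledIntegral.
Variables (K : fieldType) (R : comNzRingType) (phi : {rmorphism R -> K}).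

(** Multiplying an equation of degree [m] for [z] by the power [m.-1] of its leading coefficient
    makes it a monic equation for the scaled element. *)
Lemma integral_lead_coef (q : {poly R}) z :
    map_poly phi q != 0 -> root (map_poly phi q) z ->
  exists2 a, phi a != 0 & integralOver phi (phi a * z).
Proof.
set P := map_poly phi q => P0 Pz; set m := (size P).-1.
have Pi i : P`_i = phi q`_i by rewrite coef_map.
have lead0 : phi q`_m != 0 by rewrite -Pi -lead_coefE lead_coef_eq0.
exists q`_m => //; set a := phi q`_m in lead0 *.
have m0 : (0 < m)%N.
  rewrite lt0n; apply/eqP => m0; move: Pz; rewrite (size1_polyC (p := P)).
    by rewrite rootC Pi -[0%N]m0 => /eqP a0; rewrite /a a0 eqxx in lead0.
  by move: m0; rewrite /m; case: (size P) => [|[]].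
(* The coefficients are chosen so that [p] takes the value [a ^+ m.-1 * P.[z]] at [a * z]. *)
pose p : {poly K} :=
  \poly_(i < m.+1) (if i == m then 1 else P`_i * a ^+ (m.-1 - i)).
have pm : p \is monic.
  by rewrite monicE lead_coef_poly ?eqxx // oner_eq0.
apply: (integral_root_monic (p := p)) => //.
- rewrite rootE /p horner_poly big_ord_recr /= eqxx mul1r.
  have : a ^+ m.-1 * P.[z] = 0 by rewrite (rootP Pz) mulr0.
  rewrite horner_coef (_ : size P = m.+1);
    last by rewrite /m prednK // size_poly_gt0.
  rewrite big_ord_recr /= mulrDr mulr_sumr => E; apply/eqP; rewrite -[RHS]E.
  congr (_ + _); last first.
    have aE : a ^+ m = a * a ^+ m.-1 by rewrite -exprS prednK.
    by rewrite Pi -/a exprMn aE; ring.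
  apply: eq_bigr => i _; rewrite ltn_eqF // exprMn.
  have -> : a ^+ m.-1 = a ^+ (m.-1 - i) * a ^+ i.
    by rewrite -exprD subnK // -ltnS prednK.
  ring.
- move=> c /(nthP 0)[i]; rewrite size_poly_eq ?eqxx ?oner_eq0 // => im <-.
  rewrite coef_poly im; case: ifP => _; first exact: integral1.
  by rewrite Pi -rmorphXn -rmorphM; apply: integral_id.
Qed.

(** Once the powers of ['X] dividing the equation are removed, its constant term [phi c] is nonzero
    and equals [- z p(z)], so [phi c / z] is a polynomial in [z]. *)
Lemma integral_recip z : integralOver phi z -> z != 0 ->
  exists2 b, phi b != 0 & integralOver phi (phi b / z).
Proof.
move=> intz z0; case: (intz) => p0 p0m.
have: map_poly phi p0 != 0 by apply/monic_neq0/monic_map.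
elim/poly_ind: {p0m} p0 => [|p c IHp]; first by rewrite rmorph0 eqxx.
rewrite rmorphD rmorphM /= map_polyX map_polyC /=.
have [->|c0] := eqVneq (phi c) 0.
  rewrite addr0 mulf_eq0 polyX_eq0 orbF rootE hornerMX mulf_eq0 (negPf z0) orbF.
  exact: IHp.
rewrite rootE hornerMXaddC => _ /eqP E; exists c => //.
have -> : phi c / z = - (map_poly phi p).[z].
  by move/eqP: E; rewrite addrC addr_eq0 => /eqP ->; rewrite -mulNr mulfK.
apply: integral_opp; apply: integral_horner => //.
by apply/integral_poly => i; rewrite coef_map; apply: integral_id.
Qed.

(** Multiplying an equation of degree [k] for the quotient by [phi t ^+ k] makes every term except
    [phi g ^+ k] a multiple of [phi t] in the image. *)
Lemma integral_quotient t g : phi t != 0 -> integralOver phi (phi g / phi t) ->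
  exists k u, phi t * phi u = phi g ^+ k.
Proof.
move=> t0 [p pm pz]; pose k := (size p).-1.
have szp : size p = k.+1 by rewrite prednK // size_poly_gt0 monic_neq0.
exists k, (- \sum_(i < k) p`_i * g ^+ i * t ^+ (k.-1 - i)).
have pk : p`_k = 1 by apply/eqP; rewrite -monicE.
have : phi t ^+ k * (map_poly phi p).[phi g / phi t] = 0.
  by rewrite (rootP pz) mulr0.
rewrite horner_coef size_map_poly_id0 ?(monicP pm) ?rmorph1 ?oner_eq0 // szp.
rewrite big_ord_recr /= coef_map /= pk rmorph1 mul1r mulrDr => /eqP.
rewrite addrC addr_eq0 expr_div_n [phi t ^+ k * _]mulrC divfK ?expf_neq0
  // => /eqP ->.
rewrite rmorphN rmorph_sum mulrN mulr_sumr mulr_sumr; congr (- _).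
apply: eq_bigr => i _; rewrite coef_map !(rmorphM, rmorphXn) /= expr_div_n.
have kk : k.-1.+1 = k by rewrite prednK // (leq_ltn_trans _ (ltn_ord i)).
have ik : (i <= k.-1)%N by rewrite -ltnS kk.
have -> : phi t ^+ k = phi t * phi t ^+ (k.-1 - i) * phi t ^+ i.
  by rewrite -mulrA -exprD subnK // -exprS kk.
by field; rewrite expf_neq0.
Qed.

End ScaledIntegral.

(** * Fields that are finitely generated as rings *)

Section FinitelyGeneratedDomain.
Variable K : fieldType.

(** Subrings of [K] are represented as images of morphisms, so adjoining [x] becomes evaluation of
    polynomials. *)
Definition eval_ext (R : comNzRingType) (phi : {rmorphism R -> K}) (x : K) :
    {rmorphism {poly R} -> K} := horner_eval x \o map_poly phi.

Lemma eval_extE (R : comNzRingType) (phi : {rmorphism R -> K}) x p :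
  eval_ext phi x p = (map_poly phi p).[x].
Proof. by []. Qed.

(* Kaplansky's G-domains: inverting one element of the image of [phi] makes it
   a field. *)
Definition Gdomain (R : comNzRingType) (phi : {rmorphism R -> K}) : Prop :=
  exists2 s, phi s != 0 &
    forall t, phi t != 0 -> exists n u, phi t * phi u = phi s ^+ n.

(** Were [x] transcendental, the nonconstant [1 + s * 'X] would divide a power of [s], although it
    is coprime to [s]. *)
Lemma Gdomain_algebraic (R : comNzRingType) (phi : {rmorphism R -> K}) x :
  Gdomain (eval_ext phi x) ->
  exists2 q, map_poly phi q != 0 & root (map_poly phi q) x.
Proof.
case=> s s0 sP; apply/not_exists2P => noalg.
have inj q : (map_poly phi q).[x] = 0 -> map_poly phi q = 0.
  move=> qx; have [/negP/negPn/eqP //|[]] := noalg q; exact/rootP.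
pose S := map_poly phi s.
have S0 : S != 0 by apply: contraNneq s0 => S0; rewrite eval_extE -/S S0 horner0.
pose t := 1 + s * 'X; pose T := map_poly phi t.
have TE : T = 1 + S * 'X by rewrite /T rmorphD rmorphM rmorph1 /= map_polyX.
have sizeT : (1 < size T)%N.
  have sSX : size (S * 'X) = (size S).+1 by rewrite size_mulX.
  have szS : (0 < size S)%N by rewrite size_poly_gt0.
  rewrite TE addrC size_polyDl sSX ?size_poly1 //.
have [|n [u]] := sP t.
  apply/eqP => /inj T0; move: sizeT; rewrite /T T0 size_poly0 //.
move/eqP; rewrite -rmorphXn -rmorphM -subr_eq0 -rmorphB => /eqP.
rewrite eval_extE => /inj /eqP;
  rewrite rmorphB rmorphM rmorphXn /= subr_eq0 => /eqP E.
have cop : coprimep T (S ^+ n).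
  apply: coprimep_expr; apply/Bezout_coprimepP; exists (1, - 'X) => /=.
  by rewrite TE mul1r mulNr [S * _]mulrC addrK eqpxx.
have : T %| S ^+ n by rewrite -E dvdp_mulIl.
by rewrite -[S ^+ n]mulr1 Gauss_dvdpr // dvdp1 => /eqP sT; rewrite sT in sizeT.
Qed.

(** For [t] in the smaller ring, [1 / t] is [u / s ^+ n] in the larger one. Powers of [a] and [b]
    make [u] and [1 / s] integral, so [integral_quotient] shows that [t] divides a power of
    [a * b]. *)
Lemma Gdomain_eval_ext (R : comNzRingType) (phi : {rmorphism R -> K}) x :
  Gdomain (eval_ext phi x) -> Gdomain phi.
Proof.
move=> Gx; have [q q0 qx] := Gdomain_algebraic Gx.
have [a a0 intax] := integral_lead_coef q0 qx.
have scaled p : exists N, integralOver phi (phi a ^+ N * eval_ext phi x p).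
  elim/poly_ind: p => [|p c [N IHp]].
    by exists 0%N; rewrite rmorph0 mulr0; apply: integral0.
  exists N.+1; rewrite eval_extE rmorphD rmorphM /= map_polyX map_polyC /=.
  rewrite hornerMXaddC -eval_extE mulrDr.
  have -> : phi a ^+ N.+1 * (eval_ext phi x p * x) =
      (phi a ^+ N * eval_ext phi x p) * (phi a * x) by rewrite exprS; ring.
  apply: integral_add; first exact: integral_mul.
  by rewrite -rmorphXn -rmorphM; apply: integral_id.
have [s s0 sP] := Gx; have [N intNs] := scaled s.
have aN0 k : phi a ^+ k != 0 by rewrite expf_neq0.
have [b b0 intb] := integral_recip intNs (mulf_neq0 (aN0 N) s0).
exists (a * b); first by rewrite rmorphM mulf_neq0.
move=> t t0; have [|n [u]] := sP t%:P.
  by rewrite eval_extE /= map_polyC hornerC.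
rewrite eval_extE /= map_polyC hornerC /= => tu.
have [M intMu] := scaled u.
have intt : integralOver phi (phi ((a * b) ^+ (M + n)) / phi t).
  have -> : phi ((a * b) ^+ (M + n)) / phi t =
      phi (a ^+ n * b ^+ M * a ^+ (N * n)) * (phi a ^+ M * eval_ext phi x u) *
      (phi b / (phi a ^+ N * eval_ext phi x s)) ^+ n.
    set y := eval_ext phi x s in s0 tu *; set v := eval_ext phi x u in tu *.
    have -> : v = y ^+ n / phi t by rewrite -tu mulrC mulKf.
    rewrite !(rmorphM, rmorphXn) /= expr_div_n !exprMn -!exprM !exprD.
    by field; rewrite t0 !expf_neq0.
  apply: integral_mul; first by apply: integral_mul => //; apply: integral_id.
  by elim: n {tu} => [|n IHn]; [exact: integral1|rewrite exprS;
    apply: integral_mul].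
have [k [u' tu']] := integral_quotient t0 intt.
by exists ((M + n) * k)%N, u'; rewrite tu' rmorphXn exprM.
Qed.

(* If the image of [phi] is finite, its nonzero elements are roots of unity, so
   [x] is integral over it, of some degree d, and the polynomials of degree
   less than d suffice. *)
Lemma finite_eval_ext (R : comNzRingType) (phi : {rmorphism R -> K}) x :
  Gdomain (eval_ext phi x) -> finite_set (range phi) ->
  finite_set (range (eval_ext phi x)).
Proof.
move=> /Gdomain_algebraic[q q0 qx] fin.
have [a a0 intax] := integral_lead_coef q0 qx.
have /finite_seqP[s sP] := fin.
have sphi r : phi r \in s by suff: [set` s] (phi r) by []; rewrite -sP; exists r.
have [k k0 ak] : exists2 k, (0 < k)%N & phi a ^+ k = 1.
  pose pows := [seq phi a ^+ n | n <- iota 0 (size s).+1].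
  have : ~~ uniq pows.
    apply/negP => /uniq_leq_size H.
    have : (size pows <= size s)%N by apply: H => _ /mapP[n _ ->];
      rewrite -rmorphXn.
    by rewrite size_map size_iota ltnn.
  case/(uniqPn 0) => i [j [ij]]; rewrite size_map size_iota => js.
  rewrite !(nth_map 0%N) ?size_iota ?(ltn_trans ij)
    // !nth_iota ?(ltn_trans ij) //.
  rewrite !add0n => E; exists (j - i)%N; first by rewrite subn_gt0.
  apply: (mulIf (expf_neq0 i a0)); rewrite mul1r -exprD subnK //; exact: ltnW.
have [p pm px] : integralOver phi x.
  have -> : x = phi (a ^+ k.-1) * (phi a * x).
    by rewrite mulrA rmorphXn -exprSr prednK // ak mul1r.
  by apply: integral_mul => //; apply: integral_id.
pose F (c : {ffun 'I_(size p) -> seq_sub s}) : K := \sum_i val (c i) * x ^+ i.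
apply: (@sub_finite_set _ _ (F @` [set: _])); last first.
  by apply: finite_image; apply: finite_finset.
move=> _ [q' _ <-]; pose r := Pdiv.CommonRing.rmodp q' p.
have rE : eval_ext phi x q' = eval_ext phi x r.
  rewrite [in LHS](Pdiv.RingMonic.rdivp_eq pm q') rmorphD rmorphM.
  by rewrite [eval_ext phi x p](rootP px) mulr0 add0r.
exists [ffun i : 'I_(size p) => SeqSub (sphi r`_i)] => //.
rewrite rE eval_extE (@horner_coef_wide _ (size p)).
  by apply: eq_bigr => i _; rewrite ffunE coef_map.
apply: leq_trans (size_poly _ _) _; apply: ltnW;
  apply: Pdiv.CommonRing.ltn_rmodpN0.
exact: monic_neq0.
Qed.

(** In characteristic zero a prime above [|s|] divides no power of [s]; otherwise finitely many
    residues exhaust the image. *)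
Lemma Gdomain_int_finite (phi : {rmorphism int -> K}) :
  Gdomain phi -> finite_set (range phi).
Proof.
case=> s s0 sP; have [[n n0 pn]|inj] :=
    pselect (exists2 n : nat, (0 < n)%N & phi n%:Z = 0).
  pose F (i : 'I_n) := phi (nat_of_ord i)%:Z.
  apply: (@sub_finite_set _ _ (F @` [set: _])); last first.
    by apply: finite_image; apply: finite_finset.
  move=> _ [z _ <-]; have n_neq0 : (n : int) != 0 by rewrite eqz_nat -lt0n.
  have zE : `|(z %% n)%Z|%N = (z %% n)%Z :> int by rewrite gez0_abs ?modz_ge0.
  have zn : (`|(z %% n)%Z| < n)%N by rewrite -ltz_nat zE ltz_pmod.
  exists (Ordinal zn) => //; rewrite /F /= zE.
  suff E : phi z = phi (z %/ n)%Z * phi n + phi (z %% n)%Z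
    by rewrite E pn mulr0 add0r.
  by rewrite -rmorphM -rmorphD -divz_eq.
have phi0 z : phi z = 0 -> z = 0.
  move=> pz; apply/eqP; rewrite -absz_eq0 -leqn0 leqNgt; apply/negP => z0.
  apply: inj; exists `|z|%N => //; have [zE|zE] := leP 0 z.
    by rewrite gez0_abs.
  by rewrite ltz0_abs // rmorphN pz oppr0.
have [p sp prime_p] := prime_above `|s|.
have [|n [u]] := sP p%:Z.
  by apply/eqP => /phi0 /eqP; rewrite eqz_nat -leqn0 leqNgt prime_gt0.
rewrite -rmorphXn -rmorphM => /eqP; rewrite -subr_eq0 -rmorphB => /eqP/phi0/eqP.
rewrite subr_eq0 => /eqP /(congr1 absz); rewrite abszM abszX /= => E.
have : (p %| `|s| ^ n)%N by rewrite -E dvdn_mulr.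
rewrite Euclid_dvdX // => /andP[/dvdn_leq]; rewrite absz_gt0 leqNgt sp.
have -> : s != 0 by apply: contraNneq s0 => ->; rewrite rmorph0.
by move=> /(_ isT).
Qed.

(** The subring generated by the image of [phi] and [xs]. Each element adds a polynomial variable to
    the domain, so [R] varies in the recursion. *)
Fixpoint adjoin (xs : seq K) (R : comNzRingType) (phi : {rmorphism R -> K}) :
  set K :=
  if xs is x :: xs then adjoin xs (eval_ext phi x) else range phi.

(** The two conclusions travel in opposite directions: being a G-domain descends from [K] to [phi],
    and is used at each stage for finiteness to climb back. *)
Lemma adjoin_finite xs (R : comNzRingType) (phi : {rmorphism R -> K}) :
    adjoin xs phi = [set: K] ->
  Gdomain phi /\ (finite_set (range phi) -> finite_set [set: K]).
Proof.
elim: xs R phi => [|x xs IHxs] R phi /=.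
  move=> phiT; rewrite phiT; split=> //; exists 1;
    first by rewrite rmorph1 oner_neq0.
  move=> t t0; have [u _ tu] : range phi (phi t)^-1 by rewrite phiT.
  by exists 1%N, u; rewrite tu divff // rmorph1.
move=> /IHxs [Gx finx]; split; first exact: Gdomain_eval_ext Gx.
by move=> fin; apply/finx/finite_eval_ext.
Qed.

Lemma adjoin_range xs (R : comNzRingType) (phi : {rmorphism R -> K}) r :
  adjoin xs phi (phi r).
Proof.
elim: xs R phi r => [|x xs IHxs] R phi r /=; first by exists r.
by have := IHxs _ (eval_ext phi x) r%:P; rewrite eval_extE /= map_polyC hornerC.
Qed.

Lemma adjoin_mem xs (R : comNzRingType) (phi : {rmorphism R -> K}) x :
  x \in xs -> adjoin xs phi x.
Proof.
elim: xs R phi => [//|y xs IHxs] R phi; rewrite inE => /orP[/eqP ->|/IHxs] /=.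
  by have := adjoin_range xs (eval_ext phi y) 'X;
    rewrite eval_extE map_polyX hornerX.
exact.
Qed.

Lemma adjoin_subM xs (R : comNzRingType) (phi : {rmorphism R -> K}) x y :
  adjoin xs phi x -> adjoin xs phi y ->
  adjoin xs phi (x - y) /\ adjoin xs phi (x * y).
Proof.
elim: xs R phi => [|z xs IHxs] R phi /=; last exact: IHxs.
move=> [a _ <-] [b _ <-]; rewrite -rmorphB -rmorphM.
by split; [exists (a - b)|exists (a * b)].
Qed.

(** Finite generation as a ring is expressed through the subrings [T] containing [xs]; the
    hypothesis is applied to [adjoin] over the integers. *)
Lemma fg_field_finite (xs : seq K) :
    (forall T : K -> Prop, T 1 -> (forall x y, T x -> T y -> T (x - y)) ->
      (forall x y, T x -> T y -> T (x * y)) -> (forall x, x \in xs -> T x) ->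
      forall x, T x) ->
  finite_set [set: K].
Proof.
move=> gen; pose phi : {rmorphism int -> K} := intr.
have [|G fin] := @adjoin_finite xs _ phi.
  rewrite -subTset => x _; apply: gen => {x}.
  - by rewrite -(rmorph1 phi); apply: adjoin_range.
  - by move=> x y Tx Ty; case: (adjoin_subM Tx Ty).
  - by move=> x y Tx Ty; case: (adjoin_subM Tx Ty).
  exact: adjoin_mem.
exact/fin/Gdomain_int_finite.
Qed.

End FinitelyGeneratedDomain.

Definition mx2 (R : nzRingType) (a b c d : R) : 'M[R]_2 :=
  \matrix_(i, j) if i == 0 then if j == 0 then a else b
                 else if j == 0 then c else d.

Lemma mx2M (R : nzRingType) (a b c d a' b' c' d' : R) :
  mx2 a b c d *m mx2 a' b' c' d' =
  mx2 (a * a' + b * c') (a * b' + b * d') (c * a' + d * c') (c * b' + d * d').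
Proof.
by apply/matrixP => i j; rewrite !mxE !big_ord_recl big_ord0 !mxE /= addr0;
  case: ifP; case: ifP.
Qed.

(** * Transvections and the group they generate *)

Section LeavittFamily.
Variables (K : fieldType) (L : algType K) (e f e' f' : L).

Definition gen_letter (i : bool) : L := if i then f else e.
Definition gen_coletter (i : bool) : L := if i then f' else e'.
(* Locked, as rewriting with [mulrA] would otherwise unfold them. *)
Definition base : bool * bool -> L :=
  locked (fun i => gen_letter i.1 * gen_letter i.2).
Definition cobase : bool * bool -> L :=
  locked (fun i => gen_coletter i.2 * gen_coletter i.1).

(** All scalar multiples are allowed, which makes this class closed under negation, and finite when
    [K] is. *)
Inductive alg_generator : L -> Prop :=
| AlgGenScalar c : alg_generator c%:A
| AlgGenLetter c i : alg_generator (c *: gen_letter i)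
| AlgGenColetter c i : alg_generator (c *: gen_coletter i).

(** The group H of the overview, given as a monoid: inverses are recovered in [elem_inv]. *)
Inductive elem : L -> Prop :=
| ElemOne : elem 1
| ElemMul x y : elem x -> elem y -> elem (x * y)
| ElemGen i j g : i != j -> alg_generator g -> elem (1 + base i * g * cobase j).

(** The paths [f^i e] for [i < n], completed by [f^n]: a complete prefix code with [n.+1]
    elements. *)
Fixpoint comb n i : L :=
  match n, i with
  | 0, _ => 1
  | n.+1, 0 => e
  | n.+1, i.+1 => f * comb n i
  end.

Fixpoint cocomb n i : L :=
  match n, i with
  | 0, _ => 1
  | n.+1, 0 => e'
  | n.+1, i.+1 => cocomb n i * f'
  end.

Hypotheses (e'e : e' * e = 1) (f'f : f' * f = 1).
Hypotheses (e'f : e' * f = 0) (f'e : f' * e = 0).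
Hypothesis sum_ef : e * e' + f * f' = 1.
Hypothesis alg_ind : forall Q : L -> Prop,
  (forall c, Q c%:A) -> Q e -> Q f -> Q e' -> Q f' ->
  (forall x y, Q x -> Q y -> Q (x + y)) ->
  (forall x y, Q x -> Q y -> Q (x * y)) -> forall x, Q x.
(* In the action on sequences, [rho x] is the image under [x] of the indicator
   of 1; it sends the paths of length d to the indicators of the integers in
   [2^d, 2^(d+1)). *)
Variable rho : L -> nat -> K.
Hypothesis rho_lin : forall c x y n, rho (c *: x + y) n = c * rho x n + rho y n.
Hypothesis rho1 : forall n, rho 1 n = (n == 1)%:R.
Hypothesis rho_e : forall x n, rho (e * x) n = if odd n then 0 else rho x n./2.
Hypothesis rho_f : forall x n, rho (f * x) n = if odd n then rho x n./2 else 0.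

Lemma alg_generatorP : forall Q : L -> Prop,
  (forall x, alg_generator x -> Q x) ->
  (forall x y, Q x -> Q y -> Q (x + y)) ->
  (forall x y, Q x -> Q y -> Q (x * y)) -> forall x, Q x.
Proof.
move=> Q QG QD QM; apply: alg_ind => // [c||||]; apply: QG; first by constructor.
- by have := AlgGenLetter 1 false; rewrite scale1r.
- by have := AlgGenLetter 1 true; rewrite scale1r.
- by have := AlgGenColetter 1 false; rewrite scale1r.
by have := AlgGenColetter 1 true; rewrite scale1r.
Qed.

Lemma coletterK i j : gen_coletter i * gen_letter j = (i == j)%:R.
Proof. by case: i; case: j. Qed.

Lemma baseE i : base i = gen_letter i.1 * gen_letter i.2.
Proof. by rewrite /base -lock. Qed.

Lemma cobaseE i : cobase i = gen_coletter i.2 * gen_coletter i.1.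
Proof. by rewrite /cobase -lock. Qed.

Lemma cobaseK i j : cobase i * base j = (i == j)%:R.
Proof.
rewrite cobaseE baseE mulrA -(mulrA (gen_coletter i.2)) coletterK.
case: i j => [i1 i2] [j1 j2] /=; rewrite xpair_eqE; case: (i1 == j1) => /=.
  by rewrite mulr1 coletterK.
by rewrite mulr0 mul0r.
Qed.

Lemma sum_letter : \sum_i gen_letter i * gen_coletter i = 1.
Proof. by rewrite big_bool /= addrC. Qed.

Lemma sum_base : \sum_i base i * cobase i = 1.
Proof.
transitivity (\sum_i \sum_j base (i, j) * cobase (i, j)).
  by rewrite pair_bigA /=; apply: eq_bigr => -[].
rewrite -sum_letter; apply: eq_bigr => i _.
rewrite -[X in X * _]mulr1 -sum_letter mulr_sumr mulr_suml.
by apply: eq_bigr => j _; rewrite baseE cobaseE !mulrA.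
Qed.

(** As [p] and [q] square to zero, this is the commutator of [1 + p] and [1 + q]: a Steinberg
    relation in abstract form. *)
Lemma commutator_nilpotent (p q : L) : p * p = 0 -> q * q = 0 -> q * p = 0 ->
  (1 + p) * (1 + q) * (1 - p) * (1 - q) = 1 + p * q.
Proof.
move=> pp qq qp.
have -> : (1 + p) * (1 + q) * (1 - p) = 1 + q + p * q.
  rewrite -mulrA [(1 + q) * _]mulrDl mul1r mulrBr mulr1 qp subr0.
  by rewrite mulrDl mul1r !mulrDr mulrN pp mulr1 oppr0 addr0 (addrAC 1 (- p) q)
    addrA subrK.
rewrite mulrBr mulr1 !mulrDl mul1r qq -mulrA qq mulr0 !addr0.
by rewrite addrAC addrK.
Qed.

Lemma elem_sum (I : Type) (r : seq I) (z : I -> L) :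
    (forall t, elem (1 + z t)) -> (forall t u, z t * z u = 0) ->
  elem (1 + \sum_(t <- r) z t).
Proof.
move=> Ez zz; elim: r => [|t r IHr]; first by rewrite big_nil addr0; constructor.
rewrite big_cons (_ : 1 + _ = (1 + z t) * (1 + \sum_(u <- r) z u)).
  exact: ElemMul.
rewrite mulrDr mulr1 mulrDl mul1r mulr_sumr [X in _ + (_ + X)]big1 ?addr0
  ?addrA //.
Qed.

Lemma other_index (i j : bool * bool) : exists k, (k != i) && (k != j).
Proof.
by case: i j => [[] []] [[] []];
  do [by exists (true, true) | by exists (false, false) |
    by exists (true, false)].
Qed.

(** Sums of entries come from products of transvections, and products of entries from commutators
    through a third index. *)
Lemma elem_base r i j : i != j -> elem (1 + base i * r * cobase j).
Proof.
(* The commutators also involve inverses, whence an induction on both signs at once. *)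
suff [] : (forall i j, i != j -> elem (1 + base i * r * cobase j)) /\
          (forall i j, i != j -> elem (1 + base i * - r * cobase j)) by auto.
move: {i j} r; apply: alg_generatorP;
  [move=> g gP|move=> x y [Ex Enx] [Ey Eny]|move=> x y [Ex Enx] [Ey Eny]].
- suff E z : alg_generator z ->
      forall i j, i != j -> elem (1 + base i * z * cobase j).
    by split; apply: E => //; case: gP => [c|c i|c i]; rewrite -scaleNr;
      constructor.
  by move=> zP i j ij; constructor.
- have A z t : (forall i j, i != j -> elem (1 + base i * z * cobase j)) ->
      (forall i j, i != j -> elem (1 + base i * t * cobase j)) ->
      forall i j, i != j -> elem (1 + base i * (z + t) * cobase j).
    move=> Ez Et i j ij.
    have -> : 1 + base i * (z + t) * cobase j =
        (1 + base i * z * cobase j) * (1 + base i * t * cobase j).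
      rewrite [RHS]mulrDr mulr1 [_ * (base i * t * _)]mulrDl mul1r.
      have -> : base i * z * cobase j * (base i * t * cobase j) = 0.
        by rewrite !mulrA -(mulrA _ (cobase j)) cobaseK eq_sym (negPf ij) mulr0
          !mul0r.
      by rewrite addr0 mulrDr mulrDl addrA.
    by apply: ElemMul; [apply: Ez|apply: Et].
  by split=> i j; [|rewrite opprD]; apply: A.
have C z t : (forall i j, i != j -> elem (1 + base i * z * cobase j)) ->
    (forall i j, i != j -> elem (1 + base i * - z * cobase j)) ->
    (forall i j, i != j -> elem (1 + base i * t * cobase j)) ->
    (forall i j, i != j -> elem (1 + base i * - t * cobase j)) ->
    forall i j, i != j -> elem (1 + base i * (z * t) * cobase j).
  move=> Ez Enz Et Ent i j ij; have [k /andP[ki kj]] := other_index i j.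
  have -> : base i * (z * t) * cobase j =
      (base i * z * cobase k) * (base k * t * cobase j).
    by rewrite !mulrA -(mulrA _ (cobase k)) cobaseK eqxx mulr1.
  have D a b c d (r s : L) : b != c ->
      (base a * r * cobase b) * (base c * s * cobase d) = 0.
    by move=> bc; rewrite !mulrA -(mulrA _ (cobase b)) cobaseK (negPf bc) mulr0
      !mul0r.
  rewrite -commutator_nilpotent ?D // 1?eq_sym //.
  have N a b r : - (base a * r * cobase b) = base a * - r * cobase b.
    by rewrite mulrN mulNr.
  rewrite !N.
  have ik : i != k by rewrite eq_sym.
  by apply: ElemMul (ElemMul (ElemMul (Ez _ _ ik) (Et _ _ kj)) (Enz _ _ ik))
    (Ent _ _ kj).
split; first exact: C.
by move=> i j ij; rewrite -mulNr; apply: C => //; rewrite opprK.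
Qed.

(** In the matrix units given by [base], no index lies in the supports of both [x] and [y], so
    [x * y] is a sum of off-diagonal terms whose mutual products vanish. *)
Lemma elem_disjoint (x y : L) : (forall i, cobase i * x = 0 \/ y * base i = 0) ->
  elem (1 + x * y).
Proof.
move=> xy.
have -> : x * y = \sum_(p : (bool * bool) * (bool * bool))
    base p.1 * (cobase p.1 * x * (y * base p.2)) * cobase p.2.
  rewrite -(pair_bigA _ (fun i j =>
    base i * (cobase i * x * (y * base j)) * cobase j)) /=.
  rewrite -[x in LHS]mul1r -[y in LHS]mulr1 -sum_base.
  rewrite [_ * x]mulr_suml [y * _]mulr_sumr mulr_suml; apply: eq_bigr => i _.
  by rewrite mulr_sumr; apply: eq_bigr => j _; rewrite !mulrA.
apply: elem_sum => [[i j]|[i j] [k l]] /=.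
  have [<-|ij] := eqVneq i j; last exact: elem_base.
  case: (xy i) => ->; rewrite ?mulr0 ?mul0r ?mulr0 ?mul0r addr0; exact: ElemOne.
rewrite !mulrA -(mulrA _ (cobase j)) cobaseK.
have [->|_] := eqVneq j k; last by rewrite mulr0 !mul0r.
rewrite mulr1 -!mulrA; case: (xy k) => [H|H].
  by rewrite [cobase k * (x * _)]mulrA H mul0r !mulr0.
by rewrite [y * (base k * _)]mulrA H mul0r !mulr0.
Qed.

(** The supports may overlap here, but an index [k] outside both exhibits the element as a
    commutator of two elements covered by [elem_disjoint]. *)
Lemma elem_avoid k (x y : L) : y * x = 0 -> cobase k * x = 0 -> y * base k = 0 ->
  elem (1 + x * y).
Proof.
move=> yx kx yk.
have -> : x * y = (x * cobase k) * (base k * y).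
  by rewrite mulrA -(mulrA x) cobaseK eqxx mulr1.
have E1 z : cobase k * z = 0 -> elem (1 + z * cobase k).
  move=> kz; apply: elem_disjoint => i; rewrite cobaseK.
  by have [<-|_] := eqVneq k i; [left|right].
have E2 z : z * base k = 0 -> elem (1 + base k * z).
  move=> zk; apply: elem_disjoint => i; rewrite cobaseK.
  by have [->|_] := eqVneq i k; [right|left].
rewrite -commutator_nilpotent.
- rewrite -mulNr -mulrN; do ![apply: ElemMul]; [exact: E1|exact: E2|..].
    by apply: E1; rewrite mulrN kx oppr0.
  by apply: E2; rewrite mulNr yk oppr0.
- by rewrite -mulrA [cobase k * (x * _)]mulrA kx mul0r mulr0.
- by rewrite -mulrA [y * (base k * _)]mulrA yk mul0r mulr0.
by rewrite -mulrA [y * (x * _)]mulrA yx mul0r mulr0.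
Qed.

(** * Whitehead's lemma and dilations *)

(** When [Y *m X] is the identity, this is [X M Y] plus the complementary idempotent [1 - X Y], so
    that matrices act on a corner of [L]. *)
Definition corner n (X : 'rV[L]_n) (Y : 'cV[L]_n) (M : 'M[L]_n) : L :=
  1 + (X *m (M - 1%:M) *m Y) 0 0.

Lemma cornerM n (X : 'rV[L]_n) (Y : 'cV[L]_n) M N : Y *m X = 1%:M ->
  corner X Y (M *m N) = corner X Y M * corner X Y N.
Proof.
move=> YX; have E (U V : 'M[L]_1) : U 0 0 * V 0 0 = (U *m V) 0 0.
  by rewrite mxE big_ord1.
have D (U V : 'M[L]_1) : U 0 0 + V 0 0 = (U + V) 0 0 by rewrite mxE.
rewrite /corner mulrDl mul1r mulrDr mulr1 E -addrA !D;
  congr (_ + fun_of_matrix _ 0 0).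
have -> : X *m (M - 1%:M) *m Y *m (X *m (N - 1%:M) *m Y) =
   X *m ((M - 1%:M) *m (N - 1%:M)) *m Y.
  by rewrite !mulmxA -(mulmxA _ Y) YX mulmx1.
rewrite -!mulmxDl -!mulmxDr; congr (_ *m _ *m _).
rewrite mulmxBr mulmx1 mulmxBl mul1mx.
rewrite [M - 1%:M + _]addrC subrK.
by rewrite [RHS]addrC addrA subrK.
Qed.

(** When [w' * w = 1], this scales by [c] along the idempotent [w * w'] and is the identity on its
    complement. *)
Definition dilation (c : K) (w w' : L) : L := 1 + (c - 1) *: (w * w').

Lemma elem_whitehead (x y x' y' : L) c : c != 0 ->
    y * x = 1 -> y' * x' = 1 -> y * x' = 0 -> y' * x = 0 ->
    (forall r, elem (1 + x * r * y')) -> (forall r, elem (1 + x' * r * y)) ->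
  elem (dilation c x y * dilation c^-1 x' y').
Proof.
move=> c0 yx yx' yx'0 y'x0 E12 E21.
pose X : 'rV[L]_2 := \row_i if i == 0 then x else x'.
pose Y : 'cV[L]_2 := \col_i if i == 0 then y else y'.
have YX : Y *m X = 1%:M.
  apply/matrixP => i j; rewrite !mxE big_ord1 !mxE.
  by case: i j => [[|[|//]] ?] [[|[|//]] ?].
have XY (A : 'M[K]_2) : corner X Y (map_mx (in_alg L) A) =
    1 + ((A 0 0 - 1) *: (x * y) + A 0 1 *: (x * y')
         + (A 1 0 *: (x' * y) + (A 1 1 - 1) *: (x' * y'))).
  rewrite /corner !mxE big_ord_recl big_ord1 !mxE !big_ord_recl !big_ord0 !mxE /=.
  have S a : a%:A - 1 = (a - 1)%:A :> L by rewrite scalerBl scale1r.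
  have -> : lift ord0 ord0 = 1 :> 'I_2 by apply: val_inj.
  by rewrite !addr0 !subr0 !S !mulr_algr !mulrDl -!scalerAl addrACA.
have T12 r : elem (corner X Y (map_mx (in_alg L) (mx2 1 r 0 1))).
  rewrite XY !mxE /= subrr !scale0r !addr0 add0r.
  by have := E12 r%:A; rewrite mulr_algr -scalerAl.
have T21 r : elem (corner X Y (map_mx (in_alg L) (mx2 1 0 r 1))).
  rewrite XY !mxE /= subrr !scale0r !addr0 !add0r.
  by have := E21 r%:A; rewrite mulr_algr -scalerAl.
have : elem (corner X Y (map_mx (in_alg L) (mx2 c 0 0 c^-1))).
  (* The first three factors give the antidiagonal matrix with entries [c] and [- c^-1], the last
     three the one with entries [-1] and [1]. *)
  have -> : mx2 c 0 0 c^-1 = mx2 1 c 0 1 *m mx2 1 0 (- c^-1) 1 *m mx2 1 c 0 1 *m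
      (mx2 1 (-1) 0 1 *m mx2 1 0 1 1 *m mx2 1 (-1) 0 1).
    by rewrite !mx2M; congr mx2; field.
  by rewrite !map_mxM !cornerM //; do ![apply: ElemMul].
rewrite XY !mxE /= !scale0r !addr0 add0r.
suff -> : dilation c x y * dilation c^-1 x' y' =
  1 + ((c - 1) *: (x * y) + (c^-1 - 1) *: (x' * y')) by [].
rewrite /dilation mulrDl mul1r mulrDr mulr1 -scalerAl -scalerAr.
rewrite -[x * y * _]mulrA [y * (x' * _)]mulrA yx'0 mul0r mulr0 !scaler0 addr0.
by rewrite -addrA; congr (_ + _); rewrite addrC.
Qed.

Lemma dilationM c d w w' : w' * w = 1 ->
  dilation c w w' * dilation d w w' = dilation (c * d) w w'.
Proof.
move=> ww; rewrite /dilation mulrDl mul1r mulrDr mulr1 -scalerAl -scalerAr.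
rewrite -[w * w' * _]mulrA [w' * (w * _)]mulrA ww mul1r scalerA -addrA.
congr (_ + _); rewrite addrA -!scalerDl; congr (_ *: _); ring.
Qed.

Lemma dilation1 w w' : dilation 1 w w' = 1.
Proof. by rewrite /dilation subrr scale0r addr0. Qed.

Lemma dilation_comm c d w w' v v' : w' * v = 0 -> v' * w = 0 ->
  dilation c w w' * dilation d v v' = dilation d v v' * dilation c w w'.
Proof.
move=> wv vw; rewrite /dilation !mulrDl !mul1r !mulrDr !mulr1 -!scalerAl
  -!scalerAr.
rewrite -[w * w' * _]mulrA [w' * (v * _)]mulrA wv -[v * v' * _]mulrA.
rewrite [v' * (w * _)]mulrA vw !mul0r !mulr0 !scaler0 !addr0.
by rewrite -!addrA; congr (_ + _); rewrite addrC.
Qed.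

Lemma dilation_split c w w' : w' * w = 1 ->
  dilation c w w' = dilation c (w * e) (e' * w') * dilation c (w * f) (f' * w').
Proof.
move=> ww; rewrite /dilation mulrDl mul1r mulrDr mulr1 -scalerAl -scalerAr.
rewrite -!mulrA [w' * (w * _)]mulrA ww mul1r [e' * (f * _)]mulrA e'f mul0r !mulr0.
rewrite !scaler0 addr0 -addrA -scalerDr; congr (_ + _ *: _).
rewrite addrC -[w' in LHS]mul1r -sum_ef mulrDl mulrDr !mulrA //.
Qed.

Lemma elem_ef r y : elem (1 + e * r * (y * f')).
Proof.
apply: elem_disjoint => -[[] j]; rewrite cobaseE baseE /=.
  by left; rewrite -!mulrA [f' * (e * _)]mulrA f'e mul0r mulr0.
by right; rewrite -!mulrA [f' * (e * _)]mulrA f'e mul0r mulr0.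
Qed.

Lemma elem_fe r y : elem (1 + f * y * r * e').
Proof.
apply: elem_disjoint => -[[] j]; rewrite cobaseE baseE /=.
  by right; rewrite mulrA e'f mul0r.
by left; rewrite -!mulrA [e' * (f * _)]mulrA e'f mul0r mulr0.
Qed.

(** [e] and [f * w] are orthogonal, so Whitehead's lemma exchanges the dilation at [e] for the one
    at [f * w]. *)
Lemma elem_dilation_pair c w w' : c != 0 -> w' * w = 1 ->
  elem (dilation c e e' * dilation c^-1 (f * w) (w' * f')).
Proof.
move=> c0 ww; apply: elem_whitehead => //.
- by rewrite -mulrA [f' * (f * _)]mulrA f'f mul1r.
- by rewrite mulrA e'f mul0r.
- by rewrite -mulrA f'e mulr0.
- by move=> r; apply: elem_ef.
by move=> r; apply: elem_fe.
Qed.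

(** In the product of the pairs for [f * e] and for [f], the factors at [e] cancel, and the dilation
    at [f] divided by the one at [f * e] leaves the one at [f * f]. *)
Lemma elem_dilation_ff c : c != 0 -> elem (dilation c (f * f) (f' * f')).
Proof.
move=> c0; have P1 := elem_dilation_pair (invr_neq0 c0) (mul1r 1).
have P2 := elem_dilation_pair c0 e'e.
have := ElemMul P2 P1; rewrite invrK mulr1 mul1r.
rewrite mulrA -(mulrA (dilation c e e')) dilation_comm; last first.
- by rewrite mulrA e'f mul0r.
- by rewrite -mulrA f'e mulr0.
rewrite mulrA dilationM // divff // dilation1 mul1r.
rewrite (dilation_split c f'f) mulrA dilationM.
  by rewrite mulVf // dilation1 mul1r.
by rewrite -mulrA [f' * (f * _)]mulrA f'f mul1r.
Qed.

Lemma elem_dilation_e c : c != 0 -> elem (dilation c e e').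
Proof.
move=> c0; have ff1 : f' * f' * (f * f) = 1.
  by rewrite -mulrA [f' * (f * _)]mulrA f'f mul1r.
have := ElemMul (elem_dilation_pair c0 f'f) (elem_dilation_ff c0).
by rewrite -mulrA dilationM // mulVf // dilation1 mulr1.
Qed.

Lemma elem_dilation_f c w w' : c != 0 -> w' * w = 1 ->
  elem (dilation c (f * w) (w' * f')).
Proof.
move=> c0 ww.
have := ElemMul (elem_dilation_e c0) (elem_dilation_pair (invr_neq0 c0) ww).
by rewrite mulrA dilationM // divff // dilation1 mul1r invrK.
Qed.

Lemma elem_dilation_1 c : c != 0 -> elem (dilation c 1 1).
Proof.
move=> c0; rewrite (dilation_split c (mulr1 1)) !mul1r !mulr1.
apply: ElemMul; first exact: elem_dilation_e.
by have := elem_dilation_f c0 (mulr1 1); rewrite mulr1 mul1r.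
Qed.

Lemma elem_inv x : elem x -> exists2 y, elem y & x * y = 1 /\ y * x = 1.
Proof.
elim=> [|u v _ [u' Eu' [uu' u'u]] _ [v' Ev' [vv' v'v]]|i j g ij gP].
- by exists 1; [constructor|rewrite mulr1].
- exists (v' * u'); first exact: ElemMul.
  by rewrite -mulrA [v * _]mulrA vv' mul1r -mulrA [u' * _]mulrA u'u mul1r.
exists (1 + base i * - g * cobase j); first exact: elem_base.
have Z : base i * g * cobase j * (base i * g * cobase j) = 0.
  by rewrite !mulrA -(mulrA _ (cobase j)) cobaseK eq_sym (negPf ij) mulr0 !mul0r.
rewrite mulrN mulNr; split.
  by rewrite mulrDl mul1r mulrBr mulr1 Z subr0 subrK.
by rewrite mulrBl mul1r mulrDr mulr1 Z addr0 addrK.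
Qed.

(** * Matrix units and dilations along a comb *)

Lemma cocombK n i j : (i <= n)%N -> (j <= n)%N ->
  cocomb n i * comb n j = (i == j)%:R.
Proof.
elim: n i j => [|n IHn] [|i] [|j] //=; rewrite ?mulr1 //.
- by move=> _ _; rewrite mulrA e'f mul0r.
- by move=> _ _; rewrite -mulrA f'e mulr0.
by move=> ilt jlt; rewrite -mulrA [f' * _]mulrA f'f mul1r IHn.
Qed.

Lemma sum_comb n : \sum_(i < n.+1) comb n i * cocomb n i = 1.
Proof.
elim: n => [|n IHn]; first by rewrite big_ord1 mulr1.
rewrite big_ord_recl /= -[RHS]sum_ef; congr (_ + _).
transitivity (\sum_(i < n.+1) f * (comb n i * cocomb n i) * f').
  by apply: eq_bigr => i _; rewrite !mulrA.
by rewrite -mulr_suml -mulr_sumr IHn mulr1.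
Qed.

(** Together with [comb_split]: lengthening a comb only splits its last path. *)
Lemma comb_lt n i : (i < n)%N -> comb n.+1 i = comb n i.
Proof. by elim: n i => [|n IHn] [|i] //= ilt; rewrite -IHn. Qed.

Lemma comb_split n :
  (comb n.+1 n = comb n n * e) * (comb n.+1 n.+1 = comb n n * f).
Proof.
elim: n => [|n [IH1 IH2]] /=; first by rewrite !mul1r mulr1.
by rewrite -!mulrA -IH1 -IH2.
Qed.

Lemma elem_comb n i j r : i != j -> (i <= n)%N -> (j <= n)%N ->
  elem (1 + comb n i * r * cocomb n j).
Proof.
case: n i j => [|n] [|i] [|j] //= ij ilt jlt.
- exact: elem_ef.
- exact: elem_fe.
(* Both paths begin with [f] here, so the index [ee] lies outside both supports. *)
apply: (@elem_avoid (false, false)); rewrite ?cobaseE ?baseE /=.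
- rewrite -!mulrA [f' * (f * _)]mulrA f'f mul1r mulrA cocombK //.
  by rewrite eq_sym; move: ij; rewrite eqSS => /negPf ->; rewrite mul0r.
- by rewrite -!mulrA [e' * (f * _)]mulrA e'f mul0r mulr0.
by rewrite -!mulrA [f' * (e * _)]mulrA f'e mul0r mulr0.
Qed.

Lemma elem_comb_dil n i c : c != 0 -> (i <= n)%N ->
  elem (dilation c (comb n i) (cocomb n i)).
Proof.
case: n i => [|n] [|i] //= c0 ilt; [exact: elem_dilation_1|exact: elem_dilation_e|].
by apply: elem_dilation_f => //; rewrite cocombK ?eqxx.
Qed.

(* Combinations of paths in [e] and [f] of length less than [d], of length [d],
   and of length at least [k]. *)
Fixpoint path_lt (d : nat) (x : L) : Prop :=
  if d is d.+1 then
    exists c y z, [/\ path_lt d y, path_lt d z & x = c%:A + (e * y + f * z)]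
  else x = 0.

Fixpoint path_hom (d : nat) (x : L) : Prop :=
  if d is d.+1 then
    exists y z, [/\ path_hom d y, path_hom d z & x = e * y + f * z]
  else exists c, x = c%:A.

Definition path_poly (x : L) : Prop := exists d, path_lt d x.

Fixpoint path_ge (k : nat) (x : L) : Prop :=
  if k is k.+1 then
    exists y z, [/\ path_ge k y, path_ge k z & x = e * y + f * z]
  else path_poly x.

(** * Closure properties of the filtrations by path length *)

Lemma path_lt0 d : path_lt d 0.
Proof.
elim: d => //= d IHd; exists 0, 0, 0; split=> //.
by rewrite scale0r !mulr0 !addr0.
Qed.

Lemma path_ltD d x y : path_lt d x -> path_lt d y -> path_lt d (x + y).
Proof.
elim: d x y => [|d IHd] x y /=; first by move=> -> ->; rewrite addr0.
move=> [a [u [v [Pu Pv ->]]]] [b [s [t [Ps Pt ->]]]].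
exists (a + b), (u + s), (v + t); split; [exact: IHd|exact: IHd|].
by rewrite addrACA -scalerDl [in RHS]mulrDr [f * (v + t)]mulrDr [in RHS]addrACA.
Qed.

Lemma path_ltZ d c x : path_lt d x -> path_lt d (c *: x).
Proof.
elim: d x => [|d IHd] x /=; first by move->; rewrite scaler0.
move=> [a [u [v [Pu Pv ->]]]]; exists (c * a), (c *: u), (c *: v).
by split; [exact: IHd|exact: IHd|rewrite !scalerDr scalerA !scalerAr].
Qed.

Lemma path_ltN d x : path_lt d x -> path_lt d (- x).
Proof. by rewrite -scaleN1r; apply: path_ltZ. Qed.

Lemma path_lt_sum d I (r : seq I) (P : pred I) (F : I -> L) :
  (forall i, P i -> path_lt d (F i)) -> path_lt d (\sum_(i <- r | P i) F i).
Proof. by move=> PF; apply: big_ind PF; [exact: path_lt0|exact: path_ltD]. Qed.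

Lemma path_lt_scalar d c : path_lt d.+1 c%:A.
Proof. by exists c, 0, 0; split;
  [exact: path_lt0|exact: path_lt0|rewrite !mulr0 !addr0]. Qed.

Lemma path_lt_step d x y :
  path_lt d x -> path_lt d y -> path_lt d.+1 (e * x + f * y).
Proof. by move=> Px Py; exists 0, x, y; split=> //; rewrite scale0r add0r. Qed.

Lemma path_ltS d x : path_lt d x -> path_lt d.+1 x.
Proof.
elim: d x => [|d IHd] x; first by move=> ->; apply: path_lt0.
by case=> c [y [z [Py Pz ->]]]; exists c, y, z; split=> //; apply: IHd.
Qed.

Lemma path_lt_le d d' x : (d <= d')%N -> path_lt d x -> path_lt d' x.
Proof. by move/subnK <-; elim: (d' - d)%N => [|k IHk] // /IHk;
  apply: path_ltS. Qed.

(** The bounds are strict: a degree below [s] and one at most [t] add up to a degree below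
    [s + t]. *)
Lemma path_ltM s t x y : path_lt s x -> path_lt t.+1 y -> path_lt (s + t) (x * y).
Proof.
move=> + Py; elim: s x => [|s IHs] x; first by move=> ->; rewrite mul0r;
  apply: path_lt0.
case=> c [u [v [Pu Pv ->]]]; rewrite mulrDl mulr_algl addSn; apply: path_ltD.
  by apply: path_lt_le (path_ltZ c Py); rewrite ltnS leq_addl.
by rewrite mulrDl -!mulrA; apply: path_lt_step; apply: IHs.
Qed.

Lemma path_hom_lt d x : path_hom d x -> path_lt d.+1 x.
Proof.
elim: d x => [|d IHd] x; first by case=> c ->; apply: path_lt_scalar.
by case=> y [z [/IHd Py /IHd Pz ->]]; apply: path_lt_step.
Qed.

Lemma path_hom0 d : path_hom d 0.
Proof.
elim: d => [|d IHd] /=; first by exists 0; rewrite scale0r.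
by exists 0, 0; rewrite !mulr0 addr0.
Qed.

Lemma path_homD d x y : path_hom d x -> path_hom d y -> path_hom d (x + y).
Proof.
elim: d x y => [|d IHd] x y /=.
  by move=> [a ->] [b ->]; exists (a + b); rewrite scalerDl.
move=> [u [v [Pu Pv ->]]] [s [t [Ps Pt ->]]].
exists (u + s), (v + t); split; [exact: IHd|exact: IHd|].
by rewrite mulrDr [f * (v + t)]mulrDr addrACA.
Qed.

Lemma path_homZ d c x : path_hom d x -> path_hom d (c *: x).
Proof.
elim: d x => [|d IHd] x /=; first by case=> a ->; exists (c * a); rewrite scalerA.
move=> [u [v [Pu Pv ->]]]; exists (c *: u), (c *: v).
by split; [exact: IHd|exact: IHd|rewrite !scalerDr !scalerAr].
Qed.

Lemma path_hom_sum d I (r : seq I) (P : pred I) (F : I -> L) :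
  (forall i, P i -> path_hom d (F i)) -> path_hom d (\sum_(i <- r | P i) F i).
Proof. by move=> PF; apply: big_ind PF; [exact: path_hom0|exact: path_homD]. Qed.

Lemma path_homM s t x y :
  path_hom s x -> path_hom t y -> path_hom (s + t) (x * y).
Proof.
move=> + Hy; elim: s x => [|s IHs] x /=.
  by case=> c ->; rewrite mulr_algl; apply: path_homZ.
case=> u [v [Hu Hv ->]]; exists (u * y), (v * y).
by split; [exact: IHs|exact: IHs|rewrite mulrDl !mulrA].
Qed.

Lemma path_lt_split d x : path_lt d.+1 x ->
  exists h l, [/\ path_hom d h, path_lt d l & x = h + l].
Proof.
elim: d x => [|d IHd] x.
  by case=> c [y [z [-> -> ->]]]; exists c%:A, 0; split=> //;
    [exists c|rewrite !mulr0 !addr0].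
case=> c [y [z [/IHd [h [l [Hh Pl ->]]] /IHd [h' [l' [Hh' Pl' ->]]] ->]]].
exists (e * h + f * h'), (c%:A + (e * l + f * l')); split.
- by exists h, h'.
- by exists c, l, l'.
by rewrite [RHS]addrCA [in RHS]addrACA -!mulrDr.
Qed.

Lemma path_polyD x y : path_poly x -> path_poly y -> path_poly (x + y).
Proof.
move=> [d Px] [d' Py]; exists (maxn d d').
by apply: path_ltD; [apply: path_lt_le Px|apply: path_lt_le Py];
  rewrite ?leq_maxl ?leq_maxr.
Qed.

Lemma path_poly_scalar c : path_poly c%:A.
Proof. by exists 1; apply: path_lt_scalar. Qed.

Lemma path_polyM x y : path_poly x -> path_poly y -> path_poly (x * y).
Proof. by move=> [d Px] [d' /path_ltS Py]; exists (d + d')%N;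
  apply: path_ltM. Qed.

Lemma path_polyN x : path_poly x -> path_poly (- x).
Proof. by case=> d Px; exists d; apply: path_ltN. Qed.

Lemma path_poly_sum I (r : seq I) (P : pred I) (F : I -> L) :
  (forall i, P i -> path_poly (F i)) -> path_poly (\sum_(i <- r | P i) F i).
Proof.
by move=> PF; apply: big_ind PF; [exists 0; apply: path_lt0|exact: path_polyD].
Qed.

Lemma path_poly_bound (I : finType) (F : I -> L) :
  (forall i, path_poly (F i)) -> exists d, forall i, path_lt d (F i).
Proof.
move=> /(_ _)/cid-/all_sig [d Pd]; exists (\max_i d i)%N => i.
by apply: path_lt_le (Pd i); apply: leq_bigmax.
Qed.

Lemma path_ge_step k x y :
  path_ge k x -> path_ge k y -> path_ge k.+1 (e * x + f * y).
Proof. by exists x, y. Qed.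

Lemma path_ge_poly k x : path_ge k x -> path_poly x.
Proof.
elim: k x => //= k IHk x [y [z [/IHk [d Py] /IHk [d' Pz] ->]]].
exists (maxn d d').+1; apply: path_lt_step;
  [apply: path_lt_le Py|apply: path_lt_le Pz].
  by rewrite leq_maxl.
by rewrite leq_maxr.
Qed.

Lemma path_ge0 k : path_ge k 0.
Proof.
elim: k => [|k IHk]; first by exists 0; apply: path_lt0.
by exists 0, 0; rewrite !mulr0 addr0.
Qed.

Lemma path_geD k x y : path_ge k x -> path_ge k y -> path_ge k (x + y).
Proof.
elim: k x y => [|k IHk] x y; first exact: path_polyD.
move=> [u [v [Pu Pv ->]]] [s [t [Ps Pt ->]]].
exists (u + s), (v + t); split; [exact: IHk|exact: IHk|].
by rewrite mulrDr [f * (v + t)]mulrDr addrACA.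
Qed.

Lemma path_ge_sum k I (r : seq I) (P : pred I) (F : I -> L) :
  (forall i, P i -> path_ge k (F i)) -> path_ge k (\sum_(i <- r | P i) F i).
Proof. by move=> PF; apply: big_ind PF; [exact: path_ge0|exact: path_geD]. Qed.

Lemma path_geZ k c x : path_ge k x -> path_ge k (c *: x).
Proof.
elim: k x => [|k IHk] x; first by case=> d Px; exists d; apply: path_ltZ.
move=> [u [v [Pu Pv ->]]]; exists (c *: u), (c *: v).
by split; [exact: IHk|exact: IHk|rewrite !scalerDr !scalerAr].
Qed.

Lemma path_geS k x : path_ge k.+1 x -> path_ge k x.
Proof.
elim: k x => [|k IHk] x; first exact: path_ge_poly.
by case=> y [z [/IHk Py /IHk Pz ->]]; exists y, z.
Qed.

Lemma path_ge_le k k' x : (k <= k')%N -> path_ge k' x -> path_ge k x.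
Proof. by move/subnK <-; elim: (k' - k)%N => [|i IHi] // /path_geS. Qed.

Lemma path_geM k l x y : path_ge k x -> path_ge l y -> path_ge (k + l) (x * y).
Proof.
move=> + Py; elim: k x => [|k IHk] x /=.
  case=> d; elim: d x => [|d IHd] x; first by move=> ->; rewrite mul0r;
    apply: path_ge0.
  case=> c [u [v [Pu Pv ->]]]; rewrite mulrDl mulr_algl; apply: path_geD.
    exact: path_geZ.
  by apply: path_geS; rewrite mulrDl -!mulrA; apply: path_ge_step; apply: IHd.
case=> u [v [Pu Pv ->]]; exists (u * y), (v * y).
by split; [exact: IHk|exact: IHk|rewrite mulrDl !mulrA].
Qed.

(** A starred letter applied to a nonempty path removes its first letter or gives zero, so it
    suffices that the paths in [y] outlast the starred letters in [x]. *)
Lemma mul_path_ge_poly x : exists k, forall y, path_ge k y -> path_poly (x * y).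
Proof.
have P0 : forall k, path_poly (0 : L) by exists 0.
elim/alg_ind: x => [c||||||].
- by exists 0 => y Py; apply: path_polyM => //; apply: path_poly_scalar.
- exists 0 => y [d Py]; exists d.+1; rewrite -[e * y]addr0 -(mulr0 f).
  by apply: path_lt_step => //; apply: path_lt0.
- exists 0 => y [d Py]; exists d.+1; rewrite -[f * y]add0r -(mulr0 e).
  by apply: path_lt_step => //; apply: path_lt0.
- exists 1 => _ [u [v [Pu Pv ->]]].
  by rewrite mulrDr !mulrA e'e e'f mul1r mul0r addr0.
- exists 1 => _ [u [v [Pu Pv ->]]].
  by rewrite mulrDr !mulrA f'e f'f mul1r mul0r add0r.
- move=> x y [k Hx] [l Hy]; exists (maxn k l) => z Pz; rewrite mulrDl.
  by apply: path_polyD; [apply: Hx|apply: Hy]; apply: path_ge_le Pz;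
    rewrite ?leq_maxl ?leq_maxr.
(* [y] uses up [l] letters and leaves [k] of them for [x]. *)
move=> x y [k Hx] [l Hy]; exists (l + k)%N => z Pz; rewrite -mulrA; apply: Hx.
elim: l y z Hy Pz => [|l IHl] y z Hy Pz.
  apply: (@path_geM 0) Pz; rewrite -[y]mulr1; apply: Hy.
  by rewrite -[1]scale1r; apply: path_poly_scalar.
case: Pz => [u [v [Pu Pv ->]]]; rewrite mulrDr !mulrA; apply: path_geD;
  apply: IHl => // w Pw.
  by rewrite -mulrA -[e * w]addr0 -(mulr0 f); apply: Hy;
    apply: path_ge_step => //; apply: path_ge0.
by rewrite -mulrA -[f * w]add0r -(mulr0 e); apply: Hy;
  apply: path_ge_step => //; apply: path_ge0.
Qed.

(** * Supports in the sequence action, and leading terms *)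

Lemma rhoD x y n : rho (x + y) n = rho x n + rho y n.
Proof. by rewrite -[x]scale1r rho_lin mul1r scale1r. Qed.

Lemma rho0 n : rho 0 n = 0.
Proof. by apply: (addrI (rho 0 n)); rewrite -rhoD !addr0. Qed.

Lemma rho_scalar c n : rho c%:A n = c * (n == 1)%:R.
Proof. by rewrite -[c%:A]addr0 rho_lin rho0 addr0 rho1. Qed.

Lemma rho_step x y n :
  rho (e * x + f * y) n = if odd n then rho y n./2 else rho x n./2.
Proof. by rewrite rhoD rho_e rho_f; case: ifP; rewrite ?add0r ?addr0. Qed.

Lemma path_lt_support d x n : path_lt d x -> (2 ^ d <= n)%N -> rho x n = 0.
Proof.
elim: d x n => [|d IHd] x n /=; first by move=> ->; rewrite rho0.
case=> c [y [z [Py Pz ->]]] dn; rewrite rhoD rho_scalar rho_step.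
have d2 : (2 ^ d <= n./2)%N by rewrite expnS in dn; lia.
have -> : (n == 1)%N = false by rewrite expnS in dn; have := expn_gt0 2 d; lia.
by rewrite (IHd y) // (IHd z) // mulr0 add0r; case: ifP.
Qed.

Lemma path_hom_support d x n : path_hom d x -> (n < 2 ^ d)%N -> rho x n = 0.
Proof.
elim: d x n => [|d IHd] x n /=.
  by case=> c -> ; rewrite expn0 rho_scalar; case: n => // _; rewrite mulr0.
case=> y [z [Hy Hz ->]] dn; rewrite rho_step.
have d2 : (n./2 < 2 ^ d)%N by rewrite expnS in dn; lia.
by rewrite (IHd y) // (IHd z) //; case: ifP.
Qed.

Lemma path_hom_rho0 d x : path_hom d x -> (forall n, rho x n = 0) -> x = 0.
Proof.
elim: d x => [|d IHd] x /=.
  by case=> c -> /(_ 1); rewrite rho_scalar mulr1 => ->; rewrite scale0r.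
case=> y [z [Hy Hz ->]] R0.
have -> : y = 0.
  by apply: IHd => // n; have := R0 n.*2; rewrite rho_step odd_double doubleK.
have -> : z = 0; last by rewrite !mulr0 addr0.
apply: IHd => // n; have := R0 n.*2.+1.
by rewrite rho_step oddS odd_double -uphalfE uphalf_double.
Qed.

(** The supports lie on the two sides of [2 ^ d]; hence the leading term of a combination of paths
    is well defined. *)
Lemma path_hom_lt_eq0 d x : path_hom d x -> path_lt d x -> x = 0.
Proof.
move=> Hx Px; apply: (path_hom_rho0 Hx) => n.
by have [/(path_hom_support Hx)|/(path_lt_support Px)] := ltnP n (2 ^ d).
Qed.

(** [g] is the starred word dual to a path that occurs in [x] with coefficient [c]; it keeps only
    the paths that begin with this one, and strips that beginning. *)
Lemma path_hom_strip s x : path_hom s x -> x <> 0 -> exists g c,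
  [/\ c != 0, g * x = c%:A &
    forall t y, path_hom (s + t) y -> path_hom t (g * y)].
Proof.
elim: s x => [|s IHs] x /=.
  case=> c -> c0; exists 1, c; split; rewrite ?mul1r //.
    by apply/eqP => c00; apply: c0; rewrite c00 scale0r.
  by move=> t y; rewrite mul1r.
case=> y [z [Hy Hz ->]] n0; have [y0|y0] := eqVneq y 0.
  have z0 : z <> 0 by move=> z0; apply: n0; rewrite y0 z0 !mulr0 addr0.
  have [g [c [c0 gz Hg]]] := IHs z Hz z0; exists (g * f'), c; split=> //.
    by rewrite y0 mulr0 add0r -mulrA [f' * _]mulrA f'f mul1r.
  move=> t _ [u [v [Hu Hv ->]]].
  by rewrite -mulrA mulrDr !mulrA f'e f'f mul0r mul1r add0r; apply: Hg.
have [g [c [c0 gz Hg]]] := IHs y Hy (elimN eqP y0); exists (g * e'), c;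
  split=> //.
  by rewrite -mulrA mulrDr !mulrA e'e e'f mul0r mul1r addr0.
move=> t _ [u [v [Hu Hv ->]]].
by rewrite -mulrA mulrDr !mulrA e'e e'f mul0r mul1r addr0; apply: Hg.
Qed.

(** * Factorizations of rows and elementary row operations *)

Definition comb_row n : 'rV[L]_n.+1 := \row_i comb n i.
Definition comb_col n : 'cV[L]_n.+1 := \col_i cocomb n i.

Lemma comb_rowK n : comb_col n *m comb_row n = 1%:M.
Proof.
apply/matrixP => i j; by rewrite !mxE big_ord1 !mxE cocombK ?leq_ord.
Qed.

Lemma comb_colK n : comb_row n *m comb_col n = 1%:M.
Proof.
apply/matrixP => i j; rewrite !ord1 [RHS]mxE eqxx mxE.
apply: etrans (sum_comb n).
by apply: eq_bigr => k _; rewrite !mxE.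
Qed.

Definition good n (b : 'rV[L]_n.+1) : Prop :=
  exists2 g, elem g & b = g *: comb_row n.

Definition factor m (w : 'rV[L]_m) n (A : 'M[L]_(n.+1, m)) : Prop :=
  exists2 b, good b & w = b *m A.

(** [b] absorbs [Y]: since [comb_col] is inverse to [comb_row], multiplying [comb_row] by [Y] on the
    right amounts to scaling it on the left by one element of [L]. *)
Lemma factor_op m (w : 'rV[L]_m) n (A : 'M[L]_(n.+1, m)) X Y :
    Y *m X = 1%:M -> elem ((comb_row n *m Y *m comb_col n) 0 0) ->
  factor w A -> factor w (X *m A).
Proof.
move=> YX EY [b [g Eg ->] ->]; exists (g *: comb_row n *m Y).
  exists (g * (comb_row n *m Y *m comb_col n) 0 0); first exact: ElemMul.
  rewrite -scalemxAl -scalerA; congr (g *: _).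
  by rewrite -mul_scalar_mx -mx11_scalar -mulmxA comb_rowK mulmx1.
by rewrite mulmxA -(mulmxA _ Y) YX mulmx1.
Qed.

Lemma elem_rank1 n (u : 'cV[L]_n.+1) (v : 'rV[L]_n.+1) :
    (forall j, u j 0 = 0 \/ v 0 j = 0) ->
  elem ((comb_row n *m (1%:M + u *m v) *m comb_col n) 0 0).
Proof.
move=> uv.
have -> : (comb_row n *m (1%:M + u *m v) *m comb_col n) 0 0 =
    1 + \sum_(p : 'I_n.+1 * 'I_n.+1)
      comb n p.1 * (u p.1 0 * v 0 p.2) * cocomb n p.2.
  rewrite mulmxDr mulmx1 mulmxDl comb_colK !mxE eqxx; congr (_ + _).
  rewrite -(pair_bigA _ (fun i j : 'I_n.+1 =>
     comb n i * (u i 0 * v 0 j) * cocomb n j)) /= exchange_big /=.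
  apply: eq_bigr => j _; rewrite !mxE mulr_suml; apply: eq_bigr => i _.
  by rewrite !mxE big_ord1.
apply: elem_sum => [[i j]|[i j] [k l]] /=.
  have [<-|ij] := eqVneq i j; last first.
    by apply: (elem_comb); rewrite ?leq_ord.
  by case: (uv i) => ->; rewrite ?mul0r ?mulr0 ?mul0r addr0; constructor.
rewrite !mulrA -(mulrA _ (cocomb _ _)) cocombK ?leq_ord //.
have [/val_inj ->|_] := eqVneq (val j) k; last by rewrite mulr0 !mul0r.
rewrite mulr1; case: (uv k) => ->.
  by rewrite mulr0 !mul0r.
by rewrite mulr0 !mul0r.
Qed.

Lemma rank1_disjoint n (u : 'cV[L]_n) (v : 'rV[L]_n) :
  (forall j, u j 0 = 0 \/ v 0 j = 0) -> u *m v *m (u *m v) = 0.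
Proof.
move=> uv; suff E : v *m u = 0 by rewrite mulmxA -(mulmxA u) E mulmx0 mul0mx.
apply/matrixP => i k; rewrite !ord1 !mxE big1 // => j _.
by case: (uv j) => ->; rewrite ?mulr0 ?mul0r.
Qed.

Lemma rank1_inv n (u : 'cV[L]_n) (v : 'rV[L]_n) :
  (forall j, u j 0 = 0 \/ v 0 j = 0) ->
  (1%:M - u *m v) *m (1%:M + u *m v) = 1%:M /\
  (1%:M + u *m v) *m (1%:M - u *m v) = 1%:M.
Proof.
move=> /rank1_disjoint E; split.
  by rewrite mulmxBl mul1mx mulmxDr mulmx1 E addr0 addrK.
by rewrite mulmxDl mul1mx mulmxBr mulmx1 E subr0 subrK.
Qed.

Lemma factor_rank1 m (w : 'rV[L]_m) n (A : 'M[L]_(n.+1, m))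
    (u : 'cV[L]_n.+1) (v : 'rV[L]_n.+1) :
  (forall j, u j 0 = 0 \/ v 0 j = 0) ->
  factor w A -> factor w ((1%:M + u *m v) *m A).
Proof.
move=> uv; apply: (@factor_op _ _ _ _ _ (1%:M - u *m v));
  first by case: (rank1_inv uv).
rewrite -mulNmx; apply: elem_rank1 => j; rewrite mxE.
by case: (uv j) => ->; [left; rewrite oppr0|right].
Qed.

Lemma rank1_mulE m n (A : 'M[L]_(n, m)) (u : 'cV[L]_n) (v : 'rV[L]_n) k l :
  ((1%:M + u *m v) *m A) k l = A k l + u k 0 * \sum_j v 0 j * A j l.
Proof.
rewrite mulmxDl mul1mx mxE -mulmxA; congr (_ + _).
by rewrite mxE big_ord1 [X in _ * X]mxE.
Qed.

Lemma factor_addrow m (w : 'rV[L]_m) n (A : 'M[L]_(n.+1, m)) i j r : i != j ->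
  factor w A -> factor w (\matrix_(k, l) (A k l + (k == i)%:R * (r * A j l))).
Proof.
move=> ij /(@factor_rank1 _ _ _ _
  (\col_k (k == i)%:R) (\row_k (r *+ (k == j)))) H.
have -> : (\matrix_(k, l) (A k l + (k == i)%:R * (r * A j l))) =
  (1%:M + \col_k (k == i)%:R *m (\row_k (r *+ (k == j)))) *m A.
  apply/matrixP => k l;
    rewrite rank1_mulE !mxE (bigD1 j) //= !mxE eqxx big1 ?addr0 //.
  by move=> t /negPf tj; rewrite mxE tj mul0r.
apply: H => k; rewrite !mxE.
by have [->|] := eqVneq k i; [right; rewrite (negPf ij)|left].
Qed.

Lemma factor_scale m (w : 'rV[L]_m) n (A : 'M[L]_(n.+1, m)) i (c : K) : c != 0 ->
  factor w A -> factor w (\matrix_(k, l) (if k == i then c *: A k l else A k l)).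
Proof.
move=> c0.
pose D (a : K) : 'M[L]_n.+1 := diag_mx (\row_k (if k == i then a else 1)%:A).
have -> : \matrix_(k, l) (if k == i then c *: A k l else A k l) = D c *m A.
  apply/matrixP => k l; rewrite mul_diag_mx !mxE.
  by case: ifP => _; rewrite ?mulr_algl ?scale1r ?mul1r.
apply: (@factor_op _ _ _ _ _ (D c^-1)).
  apply/matrixP => k l; rewrite mul_diag_mx !mxE.
  case: (eqVneq k l) => [->|_]; last by rewrite mulr0n mulr0.
  rewrite !mulr1n; case: ifP => _; rewrite mulr_algl scalerA ?mul1r ?scale1r //.
  by rewrite mulVf // scale1r.
have -> : (comb_row n *m D c^-1 *m comb_col n) 0 0 =
    dilation c^-1 (comb n i) (cocomb n i).
  rewrite /dilation -[X in X + _ *: _](sum_comb n) mul_mx_diag mxE.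
  rewrite (bigD1 i) //= [in RHS](bigD1 i) //= !mxE eqxx addrAC; congr (_ + _).
    rewrite mulr_algr -scalerAl -[X in X + _ *: _]scale1r -scalerDl.
    by rewrite addrC subrK.
  by apply: eq_bigr => k /negPf ki; rewrite !mxE ki scale1r mulr1.
by apply: (elem_comb_dil); rewrite ?invr_neq0 ?leq_ord.
Qed.

Lemma factor_xrow m (w : 'rV[L]_m) n (A : 'M[L]_(n.+1, m)) i j :
  factor w A -> factor w (xrow i j A).
Proof.
have [<-|ij] := eqVneq i j; first by rewrite /xrow tperm1 row_perm1.
have ji : j != i by rewrite eq_sym.
(* A swap is three row additions followed by a change of sign. *)
move=> /(factor_addrow 1 ij) /(factor_addrow (-1) ji) /(factor_addrow 1 ij).
move=> /(@factor_scale _ _ _ _ j (-1)); rewrite oppr_eq0 oner_eq0 => /(_ isT).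
congr factor; apply/matrixP => k l; rewrite !mxE eqxx.

rewrite [j == i]eq_sym (negPf ij).
case: tpermP => [->|->|/eqP/negPf ki /eqP/negPf kj].
- by rewrite !eqxx (negPf ij) !mul1r !mul0r !addr0 mulN1r [LHS]addrC subrK.
- by rewrite !eqxx (negPf ji) !mul1r !mul0r !addr0 mulN1r scaleN1r opprB addrK.
by rewrite ki kj !mul0r !addr0.
Qed.

Local Arguments comb : simpl never.

(** The last path [f^n] splits into [f^n e] and [f^n f], and the last row of [A] accordingly into
    [x] and [y]. Any other row is first swapped to this end. *)
Lemma factor_split m (w : 'rV[L]_m) n (A : 'M[L]_(n.+1, m)) (x y : 'rV[L]_m) :
    (forall l, A ord_max l = e * x 0 l + f * y 0 l) -> factor w A ->
  factor w (\matrix_(k < n.+2, l < m) oapp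
     (fun k' => if k' == ord_max then x 0 l else A k' l)
     (y 0 l) (unlift ord_max k)).
Proof.
move=> Axy [b [g Eg ->] ->]; exists (g *: comb_row n.+1); first by exists g.
rewrite -!scalemxAl; congr (_ *: _); apply/rowP => l.
rewrite !mxE big_ord_recr [in RHS]big_ord_recr /= [in RHS]big_ord_recr /= !mxE.
rewrite unlift_none /= Axy mulrDr !mulrA !comb_split.
have E k : widen_ord (leqnSn n.+1) k = lift ord_max k by apply: val_inj;
  rewrite /= /bump leqNgt ltn_ord.
rewrite E liftK /= eqxx addrA; congr (_ + _ + _).
  apply: eq_bigr => k _; rewrite !mxE E liftK -(comb_lt (ltn_ord k)).
  have -> : nat_of_ord k = lift ord_max (widen_ord (leqnSn n) k) by rewrite -E.
  rewrite /=.
  have /negPf -> // : widen_ord (leqnSn n) k != ord_max.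
  by rewrite -val_eqE /= neq_ltn ltn_ord.
Qed.

Lemma good_inv n b : @good n b ->
  exists b' : 'cV[L]_n.+1, b *m b' = 1%:M /\ b' *m b = 1%:M.
Proof.
case=> g /(elem_inv) [h _ [gh hg]] ->.
exists (comb_col n *m h%:M); split.
  by rewrite -scalemxAl mulmxA comb_colK mul1mx scale_scalar_mx gh.
by rewrite -mul_scalar_mx mulmxA -(mulmxA _ h%:M) -scalar_mxM hg mulmx1 comb_rowK.
Qed.

Lemma factor_inv m (w : 'rV[L]_m) w' n (A : 'M[L]_(n.+1, m)) :
    w *m w' = 1%:M -> w' *m w = 1%:M -> factor w A ->
  exists B, A *m B = 1%:M /\ B *m A = 1%:M.
Proof.
move=> ww' w'w [b /good_inv[b' [bb' b'b]] wE]; exists (w' *m b).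
have -> : A = b' *m w by rewrite wE mulmxA b'b mul1mx.
rewrite mulmxA -(mulmxA _ w) ww' mulmx1 b'b; split=> //.
by rewrite mulmxA -(mulmxA _ b) bb' mulmx1 w'w.
Qed.

Lemma scalar_mx_inv_free n m (A : 'M[L]_(n, m)) B (v : 'rV[K]_n) :
  A *m B = 1%:M -> map_mx (in_alg L) v *m A = 0 -> v = 0.
Proof.
move=> AB vA; apply/matrixP => i j; rewrite mxE.
have : map_mx (in_alg L) v = 0 by rewrite -[LHS]mulmx1 -AB mulmxA vA mul0mx.
move/matrixP/(_ i j); rewrite !mxE => /eqP.
by rewrite (fmorph_eq0 (in_alg L)) => /eqP.
Qed.

(** * Removing the left kernel of the constant term *)

(** A row of bound [p.+1] becomes two rows of bound [p]. The weights decrease since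
    [2 * 3 ^ p < 3 ^ p.+1]; base 2 would give equality. *)
Lemma split_reduces m (w : 'rV[L]_m) n (A : 'M[L]_(n.+1, m)) d i
    (x y : 'rV[L]_m) :
    (0 < d i)%N -> (forall k l, path_lt (d k) (A k l)) ->
    (forall l, A i l = e * x 0 l + f * y 0 l) ->
    (forall l, path_lt (d i).-1 (x 0 l)) ->
    (forall l, path_lt (d i).-1 (y 0 l)) ->
    factor w A ->
  exists (A' : 'M[L]_(n.+2, m)) d', [/\ factor w A',
    forall k l, path_lt (d' k) (A' k l) & (\sum_k 3 ^ d' k < \sum_k 3 ^ d k)%N].
Proof.
move=> di PA Ai Px Py /(factor_xrow i ord_max) /factor_split-/(_ x y) H.
pose d' (k : 'I_n.+2) := oapp (fun k' : 'I_n.+1 =>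
  if k' == ord_max then (d i).-1 else d (tperm i ord_max k')) (d i).-1
  (unlift ord_max k).
eexists; exists d'; split.
- by apply: H => l; rewrite mxE tpermR.
- move=> k l; rewrite !mxE /d'; case: unliftP => [k'|] _ //=.
  by case: ifP => _ //; rewrite mxE.
rewrite [ltnRHS](reindex_inj (@perm_inj _ (tperm i ord_max))) /=.
rewrite big_ord_recr /= [ltnRHS](bigD1 ord_max) //= tpermR /d' unlift_none /=.
have E (k : 'I_n.+1) : widen_ord (leqnSn n.+1) k = lift ord_max k.
  by apply: val_inj; rewrite /= /bump leqNgt ltn_ord.
under eq_bigr => k _ do rewrite E liftK /=.
rewrite (bigD1 ord_max) //= eqxx.
rewrite [X in (_ + X + _)%N](_ : _ =
  \sum_(k < n.+1 | k != ord_max) 3 ^ d (tperm i ord_max k))%N.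
  case: (d i) di => // p _; rewrite /= expnS.
  have p3 : (0 < 3 ^ p)%N by rewrite expn_gt0.
  by rewrite addnAC ltn_add2r; move: (3 ^ p)%N p3 => q; lia.
by apply: eq_bigr => k /negPf ->.
Qed.

Lemma factor_constant_term_free m (w : 'rV[L]_m) w' n (A : 'M[L]_(n.+1, m)) d :
    w *m w' = 1%:M -> w' *m w = 1%:M ->
    factor w A -> (forall k l, path_lt (d k) (A k l)) ->
  exists n' (A' : 'M[L]_(n'.+1, m)) (C : 'M[K]_(n'.+1, m)),
    [/\ factor w A', row_free C & forall k l, path_ge 1 (A' k l - (C k l)%:A)].
Proof.
move=> ww' w'w.
have [N leN] := ubnP (\sum_k 3 ^ d k)%N.
elim: N n A d leN => // N IHN n A d leN stA PA.
have /cid [c /cid [x /cid [y cxy]]] :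
    exists (c : 'I_n.+1 -> 'I_m -> K) (x y : 'I_n.+1 -> 'I_m -> L),
    forall k l, [/\ path_lt (d k).-1 (x k l), path_lt (d k).-1 (y k l) &
       A k l = (c k l)%:A + (e * x k l + f * y k l)].
  have H k l : exists t : K * L * L,
     [/\ path_lt (d k).-1 t.1.2, path_lt (d k).-1 t.2 &
       A k l = t.1.1%:A + (e * t.1.2 + f * t.2)].
    have := PA k l; case: (d k) => [|p] /=.
      by move=> ->; exists (0, 0, 0); rewrite scale0r !mulr0 !addr0.
    by case=> c [x [y [Px Py ->]]]; exists (c, x, y).
  exists (fun k l => (sval (cid (H k l))).1.1),
    (fun k l => (sval (cid (H k l))).1.2),
    (fun k l => (sval (cid (H k l))).2) => k l.
  by case: (cid (H k l)).
have [Cfree|] := boolP (row_free (\matrix_(k, l) c k l)).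
  exists n, A, (\matrix_(k, l) c k l); split=> // k l.
  have [Px Py ->] := cxy k l; rewrite mxE addrC addKr.
  by exists (x k l), (y k l); split=> //=; exists (d k).-1.
rewrite -kermx_eq0 => /rowV0Pn [v /sub_kermxP vC v0].
have /rV0Pn [i0 vi0] := v0.
(* Among the rows involved in the relation [v], one of highest bound is replaced, so that the
   combination does not exceed it. *)
case: (@arg_maxnP _ i0 (fun i => v 0 i != 0) d vi0) => i vi maxi.
(* If this bound is zero, all the rows involved vanish, and [v] would annihilate the invertible
   matrix [A]. *)
have [di0|di] := posnP (d i).
  have [B [AB _]] := factor_inv ww' w'w stA.
  case/eqP: v0; apply: (scalar_mx_inv_free AB); apply/rowP => l.
  rewrite !mxE big1 // => k _; rewrite !mxE.
  have [->|vk] := eqVneq (v 0 k) 0; first by rewrite rmorph0 mul0r.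
  have dk : d k = 0%N by apply/eqP; rewrite -leqn0 -di0; exact: maxi.
  by have := PA k l; rewrite dk => ->; rewrite mulr0.
pose u : 'cV[L]_n.+1 := \col_k (k == i)%:R.
pose v' : 'rV[L]_n.+1 := \row_k (if k == i then 0 else (v 0 k / v 0 i)%:A).
have uv : forall j, u j 0 = 0 \/ v' 0 j = 0.
  by move=> j; rewrite !mxE; case: eqVneq => _; [right|left].
pose X : 'rV[L]_m := \row_l \sum_k (v 0 k / v 0 i) *: x k l.
pose Y : 'rV[L]_m := \row_l \sum_k (v 0 k / v 0 i) *: y k l.
have PXY (z : 'I_n.+1 -> 'I_m -> L) l : (forall k, path_lt (d k).-1 (z k l)) ->
    path_lt (d i).-1 (\sum_k (v 0 k / v 0 i) *: z k l).
  move=> Pz; apply: path_lt_sum => k _; have [->|vk] := eqVneq (v 0 k) 0.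
    by rewrite mul0r scale0r; apply: path_lt0.
  apply: path_ltZ; apply: path_lt_le (Pz k); rewrite -!subn1.
  by apply: leq_sub2r; exact: maxi.
have PX l : path_lt (d i).-1 (X 0 l) by rewrite mxE; apply: PXY => k;
  case: (cxy k l).
have PY l : path_lt (d i).-1 (Y 0 l) by rewrite mxE; apply: PXY => k;
  case: (cxy k l).
(* The operation turns row [i] into [v A] divided by [v 0 i], whose constant term vanishes because
   [v] is in the left kernel. *)
have Ai l : ((1%:M + u *m v') *m A) i l = e * X 0 l + f * Y 0 l.
  rewrite rank1_mulE /u mxE eqxx mul1r.
  have -> : A i l + \sum_j v' 0 j * A j l = \sum_j (v 0 j / v 0 i) *: A j l.
    rewrite (bigD1 i) //= [in RHS](bigD1 i) //= divff
      // scale1r mxE eqxx mul0r add0r.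
    by congr (_ + _); apply: eq_bigr => j /negPf ji; rewrite mxE ji mulr_algl.
  transitivity (\sum_j ((v 0 j / v 0 i * c j l)%:A +
      (e * ((v 0 j / v 0 i) *: x j l) + f * ((v 0 j / v 0 i) *: y j l)))).
    apply: eq_bigr => j _; have [_ _ ->] := cxy j l.
    by rewrite 2!scalerDr scalerA !scalerAr.
  rewrite !big_split /= -!mulr_sumr !mxE -[RHS]add0r; congr (_ + _).
  rewrite -scaler_suml; have /matrixP/(_ 0 l) := vC; rewrite !mxE => vc.
  suff -> : \sum_j (v 0 j / v 0 i * c j l) = 0 by rewrite scale0r.
  transitivity ((\sum_j v 0 j * c j l) / v 0 i).
    by rewrite mulr_suml; apply: eq_bigr => j _; rewrite mulrAC.
  suff -> : \sum_j v 0 j * c j l = 0 by rewrite mul0r.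
  by rewrite -[RHS]vc; apply: eq_bigr => j _; rewrite mxE.
have PA1 k l : path_lt (d k) (((1%:M + u *m v') *m A) k l).
  have [->|ki] := eqVneq k i; first by rewrite Ai -(prednK di);
    apply: path_lt_step.
  by rewrite rank1_mulE /u mxE (negPf ki) mul0r addr0.
have [A' [d' [stA' PA' lt']]] :=
  split_reduces di PA1 Ai PX PY (factor_rank1 uv stA).
by apply: IHN stA' PA'; apply: leq_trans lt' _.
Qed.

(** * Inverses over the path algebra and the weak algorithm *)

Lemma mx_path_ge_mul k l m n p (A : 'M[L]_(m, n)) (B : 'M[L]_(n, p)) :
  (forall i j, path_ge k (A i j)) -> (forall i j, path_ge l (B i j)) ->
  forall i j, path_ge (k + l) ((A *m B) i j).
Proof. by move=> PA PB i j; rewrite mxE; apply: path_ge_sum => h _;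
  apply: path_geM. Qed.

(* Here [A = C + Z'] with [Z'] without constant term; if [R] is a right inverse
   of [C], then [B = R - B Z] with [Z = Z' R].  Iterating this, [B] is the sum of
   a matrix over the path algebra and of [B (- Z)^k], which has entries in the
   path algebra for [k] large. *)
Lemma inverse_path_poly n m (A : 'M[L]_(n, m)) (B : 'M[L]_(m, n))
    (C : 'M[K]_(n, m)) :
    B *m A = 1%:M -> row_free C -> (forall k l, path_ge 1 (A k l - (C k l)%:A)) ->
  forall i j, path_poly (B i j).
Proof.
move=> BA /row_freeP[R CR] PAC.
pose R' := map_mx (in_alg L) R.
have PR i j : path_poly (R' i j) by rewrite mxE; apply: path_poly_scalar.
pose Z := (A - map_mx (in_alg L) C) *m R'.
have PZ : forall i j, path_ge (1 + 0) (Z i j).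
  by apply: mx_path_ge_mul => // i j; rewrite !mxE; apply: PAC.
have BZ : B = R' - B *m Z.
  rewrite /Z mulmxA mulmxBr BA mulmxBl mul1mx -mulmxA -map_mxM CR map_mx1 mulmx1.
  by rewrite opprB addrC subrK.
have approx k : exists Q W, [/\ B = Q + B *m W, forall i j, path_poly (Q i j) &
    forall i j, path_ge k (W i j)].
  elim: k => [|k [Q [W [BQ PQ PW]]]].
    exists 0, 1%:M; split; first by rewrite add0r mulmx1.
      by move=> i j; rewrite mxE; exists 0%N.
    by move=> i j; rewrite mxE; exists 1%N; case: eqP => _;
      [rewrite -[1]scale1r; apply: path_lt_scalar|apply: path_lt0].
  exists (Q + R' *m W), (- (Z *m W)); split.
  - by rewrite mulmxN mulmxA -addrA -mulmxBl -BZ.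
  - move=> i j; rewrite mxE; apply: path_polyD => //; rewrite mxE.
    by apply: path_poly_sum => h _; apply: path_polyM => //;
      apply: path_ge_poly (PW _ _).
  move=> i j; rewrite mxE -scaleN1r; apply: path_geZ.
  by apply: (mx_path_ge_mul PZ PW).
have [kB HB] : {kB : 'I_m -> 'I_n -> nat |
    forall i j y, path_ge (kB i j) y -> path_poly (B i j * y)}.
  have H i j := cid (mul_path_ge_poly (B i j)).
  by exists (fun i j => sval (H i j)) => i j; case: (H i j).
have [Q [W [-> PQ PW]]] := approx (\max_i \max_j kB i j)%N.
move=> i j; rewrite mxE; apply: path_polyD => //; rewrite mxE.
apply: path_poly_sum => h _; apply: HB; apply: path_ge_le (PW _ _).
apply: leq_trans (leq_bigmax i); exact: (leq_bigmax h).
Qed.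

(* In [B A = 1] the terms of highest degree of a suitable row cancel; stripping
   a path from the left turns this into a relation between the leading terms of
   the rows of [A] in which a row of highest degree has coefficient 1. *)
Lemma weak_algorithm m n (A : 'M[L]_(n.+1, m)) (B : 'M[L]_(m, n.+1))
    (d : 'I_n.+1 -> nat) j0 :
    A *m B = 1%:M -> B *m A = 1%:M -> (forall i j, path_poly (B i j)) ->
    (forall k l, path_lt (d k).+1 (A k l)) -> (0 < d j0)%N ->
  exists j (p : 'rV[L]_n.+1), [/\ p 0 j = 0, forall k, path_poly (p 0 k),
    (0 < d j)%N & forall l, path_lt (d j) (A j l + \sum_k p 0 k * A k l)].
Proof.
move=> AB BA PB PA dj0.
have [i Bij0] : exists i, B i j0 != 0.
  apply/not_existsP => B0; have /matrixP/(_ j0 j0) := AB.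
  rewrite !mxE eqxx big1 => [/eqP|k _]; first by rewrite eq_sym oner_eq0.
  by have /negP/negPn/eqP -> := B0 k; rewrite mulr0.
pose b j := B i j.
have [E0 PE0] : exists E, forall j, path_lt (E - d j) (b j).
  have [D PD] := path_poly_bound (PB i); exists (D + \max_j d j)%N => j.
  by apply: path_lt_le (PD j); rewrite -addnBA ?leq_addr //; apply: leq_bigmax.
(* The subtraction is truncated, so [b j] is zero as soon as [E <= d j]. *)
have exE : exists E, `[< forall j, path_lt (E - d j) (b j) >] by exists E0;
  apply/asboolP.
case: (ex_minnP exE) => E /asboolP PE minE {E0 PE0 exE}.
have dE : (d j0 < E)%N.
  rewrite ltnNge; apply: contra Bij0 => Ed; have := PE j0.
  by rewrite (eqP Ed) => /= b0; apply/eqP.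
case: E => // E in PE minE dE *; rewrite ltnS in dE.
have split_b j : exists t : L * L, [/\ b j = t.1 + t.2, path_lt (E - d j) t.2,
    (d j <= E)%N -> path_hom (E - d j) t.1 & (E < d j)%N -> t.1 = 0].
  have := PE j; have [dj|dj] := leqP (d j) E.
    by rewrite subSn // => /path_lt_split[h [l [Hh Pl ->]]]; exists (h, l).
  rewrite (eqP (_ : _ - _ == 0)%N) /=; last by rewrite subn_eq0.
  by move->; exists (0, 0); rewrite addr0; split=> //; apply: path_lt0.
pose h j := (sval (cid (split_b j))).1; pose lo j := (sval (cid (split_b j))).2.
have hloP j : [/\ b j = h j + lo j, path_lt (E - d j) (lo j),
    (d j <= E)%N -> path_hom (E - d j) (h j) & (E < d j)%N -> h j = 0].
  by rewrite /h /lo; case: cid.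
have split_A j l : exists t : L * L,
    [/\ A j l = t.1 + t.2, path_lt (d j) t.2 & path_hom (d j) t.1].
  by have [t [s [Ht Ps ->]]] := path_lt_split (PA j l); exists (t, s).
pose T j l := (sval (cid (split_A j l))).1;
  pose S j l := (sval (cid (split_A j l))).2.
have TSP j l :
    [/\ A j l = T j l + S j l, path_lt (d j) (S j l) & path_hom (d j) (T j l)].
  by rewrite /T /S; case: cid.
have path_lt_mul_low s j x l : path_lt s.+1 x -> path_lt (s + d j) (x * S j l).
  move=> Px; have [_ PS _] := TSP j l; case: (d j) PS => [|t] PS.
    by rewrite PS mulr0; apply: path_lt0.
  by rewrite addnS -addSn; apply: path_ltM.
(* These are the terms of total degree [E] in row [i] of [B A]; the identity matrix contributes
   none, since [E >= d j0 > 0]. *)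
have sum_hT l : \sum_j h j * T j l = 0.
  apply: (path_hom_lt_eq0 (d := E)).
    apply: path_hom_sum => j _; have [_ _ Hh h0] := hloP j;
      have [_ _ HT] := TSP j l.
    have [dj|/h0 ->] := leqP (d j) E; last by rewrite mul0r; apply: path_hom0.
    by rewrite -(subnK dj); apply: path_homM => //; apply: Hh.
  have -> : \sum_j h j * T j l =
      (i == l)%:R - \sum_j lo j * A j l - \sum_j h j * S j l.
    have /matrixP/(_ i l) := BA; rewrite !mxE => <-.
    rewrite -!sumrB; apply: eq_bigr => j _.
    have [bE _ _ _] := hloP j; have [-> _ _] := TSP j l.
    by rewrite -/(b j) bE mulrDl addrK mulrDr addrK.
  apply: path_ltD; last apply: path_ltN; [apply: path_ltD; last apply: path_ltN|].
  - apply: (@path_lt_le 1); first by lia.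
    case: eqP => _; last exact: path_lt0.
    by rewrite -[1]scale1r; apply: path_lt_scalar.
  - apply: path_lt_sum => j _; have [_ Pl _ _] := hloP j.
    have [dj|dj] := leqP (d j) E; first by rewrite -{1}(subnK dj);
      apply: path_ltM.
    move: Pl; rewrite (eqP (_ : _ - _ == 0)%N) /= ?subn_eq0 1?ltnW // => ->.
    by rewrite mul0r; apply: path_lt0.
  apply: path_lt_sum => j _; have [_ _ Hh h0] := hloP j.
  have [dj|/h0 ->] := leqP (d j) E; last by rewrite mul0r; apply: path_lt0.
  by rewrite -{1}(subnK dj); apply: path_lt_mul_low; apply: path_hom_lt;
    apply: Hh.
have [j1 hj1] : exists j, h j != 0.
  apply/not_existsP => h0; have : (E.+1 <= E)%N; last by rewrite ltnn.
  apply: minE; apply/asboolP => j; have [-> Pl _ _] := hloP j.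
  by have /negP/negPn/eqP -> := h0 j; rewrite add0r.
case: (@arg_maxnP _ j1 (fun j => h j != 0) d hj1) => j hj maxj.
have hE k : h k != 0 -> (d k <= E)%N.
  by move=> hk; rewrite leqNgt; apply: contra hk => dk; have [_ _ _ ->] := hloP k.
have Hh k : h k != 0 -> path_hom (E - d k) (h k).
  by move=> hk; have [_ _ H _] := hloP k; apply: H; apply: hE.
have [g [c [c0 ghj Hg]]] := path_hom_strip (Hh j hj) (elimN eqP hj).
pose q k := c^-1 *: (g * h k).
have qj : q j = 1 by rewrite /q ghj scalerA mulVf // scale1r.
have Pq k : q k <> 0 -> (d k <= d j)%N /\ path_hom (d j - d k) (q k).
  move=> qk; have hk : h k != 0 by apply/eqP => hk; apply: qk;
    rewrite /q hk mulr0 scaler0.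
  have dk : (d k <= d j)%N by exact: maxj.
  split=> //; apply: path_homZ; apply: Hg; have := Hh k hk.
  by rewrite addnBA // subnK //; apply: hE.
have sum_qT l : \sum_k q k * T k l = 0.
  transitivity (c^-1 *: (g * \sum_k h k * T k l));
    last by rewrite sum_hT mulr0 scaler0.
  by rewrite mulr_sumr scaler_sumr; apply: eq_bigr => k _;
    rewrite /q -scalerAl mulrA.
have sum_qA l : path_lt (d j) (\sum_k q k * A k l).
  have -> : \sum_k q k * A k l = \sum_k q k * S k l.
    transitivity (\sum_k q k * T k l + \sum_k q k * S k l);
      last by rewrite sum_qT add0r.
    rewrite -big_split /=; apply: eq_bigr => k _.
    by have [-> _ _] := TSP k l; rewrite mulrDr.
  apply: path_lt_sum => k _; have [->|/eqP/Pq[dk Hk]] := eqVneq (q k) 0.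
    by rewrite mul0r; apply: path_lt0.
  by rewrite -{1}(subnK dk); apply: path_lt_mul_low; apply: path_hom_lt.
exists j, (\row_k if k == j then 0 else q k); split.
- by rewrite mxE eqxx.
- move=> k; rewrite mxE; case: eqP => _; first by exists 0%N.
  have [->|/eqP/Pq[dk Hk]] := eqVneq (q k) 0; first by exists 0%N.
  by exists (d j - d k).+1; apply: path_hom_lt.
(* Otherwise [q A = 0] although [q j = 1], which the right inverse [B] excludes. *)
- rewrite lt0n; apply/eqP => dj.
  have qA : \row_k q k *m A = 0.
    apply/rowP => l; have := sum_qA l; rewrite dj /= => E0.
    by rewrite !mxE -[RHS]E0; apply: eq_bigr => k _; rewrite mxE.
  have : \row_k q k = 0 by rewrite -[LHS]mulmx1 -AB mulmxA qA mul0mx.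
  by move/rowP/(_ j)/eqP; rewrite !mxE qj oner_eq0.
move=> l; suff -> :
  A j l + \sum_k (\row_k (if k == j then 0 else q k)) 0 k * A k l =
  \sum_k q k * A k l by [].
rewrite (bigD1 j) //= mxE eqxx mul0r add0r [RHS](bigD1 j) //= qj mul1r;
  congr (_ + _).
by apply: eq_bigr => k /negPf kj; rewrite mxE kj.
Qed.

(** The sum of the degree bounds decreases, and the row operations have coefficients in the path
    algebra, so the inverse keeps its entries there. *)
Lemma factor_constant m (w : 'rV[L]_m) n (A : 'M[L]_(n.+1, m))
    (B : 'M[L]_(m, n.+1)) d :
    factor w A -> A *m B = 1%:M -> B *m A = 1%:M ->
    (forall i j, path_poly (B i j)) ->
    (forall k l, path_lt (d k).+1 (A k l)) ->
  exists C : 'M[K]_(n.+1, m), factor w (map_mx (in_alg L) C).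
Proof.
have [N leN] := ubnP (\sum_k d k)%N.
elim: N A B d leN => // N IHN A B d leN stA AB BA PB PA.
have [/existsP[j0 dj0]|] := boolP [exists j, 0 < d j]%N; last first.
  rewrite negb_exists => /forallP d0.
  have H k l : exists c, A k l = c%:A.
    have := PA k l; have := d0 k; rewrite -eqn0Ngt => /eqP ->.
    by case=> c [y [z [-> -> ->]]]; exists c; rewrite !mulr0 !addr0.
  exists (\matrix_(k, l) sval (cid (H k l))).
  suff -> : map_mx (in_alg L) (\matrix_(k, l) sval (cid (H k l))) = A by [].
  by apply/matrixP => k l; rewrite !mxE; case: cid.
have [j [p [pj Pp dj PAj]]] := weak_algorithm AB BA PB PA dj0.
pose u : 'cV[L]_n.+1 := \col_k (k == j)%:R.
have uv : forall k, u k 0 = 0 \/ p 0 k = 0.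
  by move=> k; rewrite mxE; case: eqVneq => [->|_]; [right|left].
have [YX XY] := rank1_inv uv.
apply: (IHN ((1%:M + u *m p) *m A) (B *m (1%:M - u *m p))
  (fun k => if k == j then (d k).-1 else d k)).
- rewrite (bigD1 j) //= eqxx.
  rewrite ltnS in leN; apply: leq_trans leN;
    rewrite [leqRHS](bigD1 j) //= -[d j in leqRHS]prednK // addSn ltnS.
  by rewrite leq_add2l; apply: eq_leq; apply: eq_bigr => k /negPf ->.
- exact: factor_rank1.
- by rewrite mulmxA -(mulmxA _ A) AB mulmx1.
- by rewrite mulmxA -(mulmxA B) YX mulmx1.
- move=> i k; rewrite mulmxBr mulmx1 !mxE; apply: path_polyD => //.
  apply: path_polyN; apply: path_poly_sum => h _; apply: path_polyM => //.
  rewrite !mxE big_ord1 !mxE.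
  by case: eqP => _; rewrite ?mul1r ?mul0r //; exists 0%N.
move=> k l; rewrite rank1_mulE mxE; case: eqVneq => [->|_].
  by rewrite mul1r prednK.
by rewrite mul0r addr0.
Qed.

(** * Gauss-Jordan elimination of constant matrices *)

Lemma constant_factor_good m (w : 'rV[L]_m) w' n (C : 'M[K]_(n.+1, m)) :
    w *m w' = 1%:M -> w' *m w = 1%:M -> factor w (map_mx (in_alg L) C) ->
  exists E : m = n.+1, good (castmx (erefl 1%N, E) w).
Proof.
move=> ww' w'w stC.
have reduce k : (k <= m)%N -> exists C : 'M[K]_(n.+1, m),
    factor w (map_mx (in_alg L) C) /\
    forall (i : 'I_n.+1) (j : 'I_m), (j < k)%N -> C i j = (i == j :> nat)%:R.
  elim: k => [|k IHk] km; first by exists C.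
  have {C stC} [C [stC CE]] := IHk (ltnW km); pose j0 := Ordinal km.
  (* Without a pivot, row [j0] of the inverse [B] vanishes at the first [k] indices and column [j0]
     of [C] at the others, so the diagonal entry of [B C] would be zero. *)
  have [i ki Ci] : exists2 i : 'I_n.+1, (k <= i)%N & C i j0 != 0.
    apply/not_exists2P => nopivot.
    have C0 (i : 'I_n.+1) : (k <= i)%N -> C i j0 = 0.
      by move=> ki; have [//|/negP/negPn/eqP] := nopivot i.
    have [B [_ BC]] := factor_inv ww' w'w stC.
    have B0 (i : 'I_n.+1) : (i < k)%N -> B j0 i = 0.
      move=> ik; have /matrixP/(_ j0 (Ordinal (ltn_trans ik km))) := BC.
      rewrite !mxE (bigD1 i) //= big1 ?addr0 => [|i' i'i].
        rewrite mxE CE // eqxx mulr1n rmorph1 mulr1 => ->.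
        by rewrite -val_eqE /= gtn_eqF.
      by rewrite mxE CE // -[_ == _]/(i' == i) (negPf i'i) mulr0n rmorph0 mulr0.
    have /matrixP/(_ j0 j0) := BC; rewrite !mxE eqxx big1 => [/eqP|i _].
      by rewrite eq_sym oner_eq0.
    rewrite mxE; have [/B0 ->|/C0 ->] := ltnP i k; first by rewrite mul0r.
    by rewrite rmorph0 mulr0.
  have kn : (k < n.+1)%N by apply: leq_ltn_trans ki _.
  pose r := Ordinal kn.
  pose D1 := xrow i r C.
  have D1r : D1 r j0 = C i j0 by rewrite mxE tpermR.
  have D1E (h : 'I_n.+1) (j : 'I_m) : (j < k)%N -> D1 h j = (h == j :> nat)%:R.
    move=> jk; rewrite mxE CE //; congr (_%:R).
    case: tpermP => [->|->|//] /=.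
      by rewrite (gtn_eqF jk) gtn_eqF // (leq_trans jk).
    by rewrite (gtn_eqF jk) gtn_eqF // (leq_trans jk).
  pose D2 : 'M[K]_(n.+1, m) := \matrix_(h, l)
    if h == r then (C i j0)^-1 * D1 h l else D1 h l.
  have D2E (h : 'I_n.+1) (j : 'I_m) : (j < k)%N -> D2 h j = (h == j :> nat)%:R.
    move=> jk; rewrite mxE !D1E //; case: eqP => // ->.
    by rewrite /= (gtn_eqF jk) mulr0.
  have D2r : D2 r j0 = 1 by rewrite mxE eqxx D1r mulVf.
  have stD2 : factor w (map_mx (in_alg L) D2).
    have := factor_scale r (invr_neq0 Ci) (factor_xrow i r stC); congr factor.
    apply/matrixP => h l; rewrite !mxE; case: eqP => _ //=.
    by rewrite scalerA.
  pose u : 'cV[K]_n.+1 := \col_h if h == r then 0 else - D2 h j0.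
  pose v : 'rV[K]_n.+1 := \row_h (h == r)%:R.
  have uv h : map_mx (in_alg L) u h 0 = 0 \/ map_mx (in_alg L) v 0 h = 0.
    by rewrite !mxE; case: eqP => _; [left|right]; rewrite rmorph0.
  exists ((1%:M + u *m v) *m D2); split.
    by rewrite map_mxM map_mxD map_mx1 map_mxM; apply: factor_rank1.
  have vD l : \sum_h v 0 h * D2 h l = D2 r l.
    rewrite (bigD1 r) //= mxE eqxx mul1r big1 ?addr0 // => h /negPf hr.
    by rewrite mxE hr mul0r.
  have E h l : ((1%:M + u *m v) *m D2) h l = D2 h l + u h 0 * D2 r l.
    rewrite mulmxDl mul1mx mxE -mulmxA; congr (_ + _).
    by rewrite mxE big_ord1 [X in _ * X]mxE vD.
  move=> h j; rewrite ltnS leq_eqVlt => /orP[/eqP jk|jk]; last first.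
    by rewrite E !D2E //= (gtn_eqF jk) mulr0 addr0.
  have -> : j = j0 by apply: val_inj.
  rewrite E D2r mulr1 [u h 0]mxE -[h == k :> nat]/(h == r).
  by case: eqP => [->|_]; rewrite ?D2r ?addr0 ?subrr.
have {C stC reduce} [C [stC CE]] := reduce m (leqnn m).
have [B [CB BC]] := factor_inv ww' w'w stC.
(* [C] is now a rectangular identity matrix; an excess row or column would be zero, against
   invertibility. *)
have [lt|gt|mn] := ltngtP m n.+1.
- have /matrixP/(_ (Ordinal lt) (Ordinal lt)) := CB.
  rewrite !mxE eqxx big1 => [/eqP|j _]; first by rewrite eq_sym oner_eq0.
  by rewrite mxE CE // gtn_eqF // rmorph0 mul0r.
- have /matrixP/(_ (Ordinal gt) (Ordinal gt)) := BC.
  rewrite !mxE eqxx big1 => [/eqP|j _]; first by rewrite eq_sym oner_eq0.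
  by rewrite mxE CE // ltn_eqF // rmorph0 mulr0.
exists mn; subst m; rewrite castmx_id.
have C1 : C = 1%:M by apply/matrixP => i j; rewrite CE // mxE.
by case: stC => b gb ->; rewrite C1 map_mx1 mulmx1.
Qed.

(** * Every unit is a product of transvections *)

Lemma path_row_good m (w : 'rV[L]_m.+1) w' :
    w *m w' = 1%:M -> w' *m w = 1%:M -> (forall i, path_poly (w 0 i)) -> good w.
Proof.
move=> ww' w'w Pw.
(* The comb with one element starts the reduction, [w] being the only row of [A]. *)
have st0 : @factor _ w 0 w.
  exists (comb_row 0); first by exists 1; [constructor|rewrite scale1r].
  suff -> : comb_row 0 = 1%:M by rewrite mul1mx.
  by apply/matrixP => i j; rewrite !ord1 !mxE.
have [d0 Pd0] := path_poly_bound Pw.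
have Pw0 (k : 'I_1) l : path_lt d0 (w k l) by rewrite ord1; apply: Pd0.
have [n [A [C [stA Cfree PA]]]] := factor_constant_term_free ww' w'w st0 Pw0.
have [B [AB BA]] := factor_inv ww' w'w stA.
have PB := inverse_path_poly BA Cfree PA.
have PA' k l : path_poly (A k l).
  rewrite -[A k l](subrK (C k l)%:A); apply: path_polyD;
    last exact: path_poly_scalar.
  exact: path_ge_poly (PA k l).
have [d Pd] := path_poly_bound (F := fun p => A p.1 p.2) (fun p => PA' p.1 p.2).
have [D stD] := factor_constant (d := fun=> d) stA AB BA PB
  (fun k l => path_ltS (Pd (k, l))).
have [mn] := constant_factor_good ww' w'w stD.
by case: (mn) => mn'; subst n; rewrite castmx_id.
Qed.

(** The row of all paths of length [k], built by putting [e] and [f] in front of the paths one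
    letter shorter. *)
Lemma deep_row k : exists m (a : 'rV[L]_m.+1) a',
  [/\ a *m a' = 1%:M, a' *m a = 1%:M &
  forall i, path_ge k (a 0 i)].
Proof.
elim: k => [|k [m [a [a' [aa' a'a Pa]]]]].
  exists 0%N, 1%:M, 1%:M; rewrite mulmx1; split=> // i; rewrite ord1 mxE eqxx.
  by exists 1%N; rewrite -[1]scale1r; apply: path_lt_scalar.
exists (m + m.+1)%N, (row_mx (e *: a) (f *: a)),
  (col_mx (a' *m e'%:M) (a' *m f'%:M)).
split.
- rewrite (@mul_row_col _ 1 m.+1 m.+1) -!scalemxAl !mulmxA aa' !mul1mx.
  by rewrite !scale_scalar_mx -raddfD /= sum_ef.
- rewrite (@mul_col_row _ m.+1 m.+1 1 m.+1 m.+1).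
  have E x y : a' *m x%:M *m (y *: a) = a' *m (x * y)%:M *m a.
    by rewrite -mulmxA mul_scalar_mx scalerA -mul_scalar_mx mulmxA.
  rewrite !E e'e e'f f'e f'f mulmx1 a'a raddf0 mulmx0 mul0mx.
  by rewrite (@scalar_mx_block _ m.+1 m.+1).
move=> i; rewrite mxE; case: split_ordP => j _; rewrite mxE.
  by exists (a 0 j), 0; rewrite mulr0 addr0; split=> //; apply: path_ge0.
by exists 0, (a 0 j); rewrite mulr0 add0r; split=> //; apply: path_ge0.
Qed.

Lemma unit_elem (x y : L) : x * y = 1 -> y * x = 1 -> elem x.
Proof.
move=> xy yx.
have [k Pk] := mul_path_ge_poly x.
have [m [a [a' [aa' a'a Pa]]]] := deep_row k.
have [g Eg aE] : good a.
  by apply: (path_row_good aa' a'a) => i; apply: path_ge_poly (Pa i).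
have [h Eh xaE] : good (x *: a).
  apply: (path_row_good (w' := a' *m y%:M)).
  - by rewrite -scalemxAl mulmxA aa' mul1mx scale_scalar_mx xy.
  - by rewrite -mulmxA mul_scalar_mx scalerA yx scale1r.
  by move=> i; rewrite mxE; apply: Pk.
have [g' Eg' [gg' g'g]] := elem_inv Eg.
(* With [c] the comb, [a = g c] and [x a = h c]; cancelling [c] leaves [x g = h]. *)
suff -> : x = h * g' by apply: ElemMul.
rewrite -[x]mulr1 -gg' mulrA; congr (_ * _).
have : (x * g)%:M *m (comb_row m *m comb_col m) =
    h%:M *m (comb_row m *m comb_col m).
  by rewrite !mulmxA !mul_scalar_mx -xaE aE scalerA.
by rewrite comb_colK !mulmx1 => /matrixP/(_ 0 0); rewrite !mxE eqxx.
Qed.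

End LeavittFamily.

(** * The action of the Leavitt algebra on sequences *)

Section LeavittAction.
Variable K : fieldType.
Local Notation L := (leavitt_alg K).

Lemma leavitt_ind (Q : L -> Prop) :
    (forall c : K, Q c%:A) -> (forall b s, Q (leavitt_gen K b s)) ->
    (forall x y, Q x -> Q y -> Q (x + y)) ->
    (forall x y, Q x -> Q y -> Q (x * y)) -> forall x, Q x.
Proof.
move=> Qc Qg QD QM x; rewrite -[x]of_quotK; move: (of_quot x) => {}x.
have Q0 : Q 0 by rewrite -[0](scale0r 1); apply: Qc.
rewrite [x]monalgE raddf_sum; apply: big_ind => // w _.
have -> : << x@_w *g w >> = x@_w *: (<< w >> : free_alg K).
  by apply/malgP => k; rewrite fgscaleE !mcoeffU mulr_natr.
rewrite /= to_quot_scalable -[_ *: _]mulr_algl; apply: (QM) => //.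
case: w => s; elim: s => [|i s IHs].
  have -> : << FMonom [::] >> = 1 :> free_alg K.
    by rewrite -fmoneE.
  by rewrite rmorph1 -[1]scale1r; apply: Qc.
have -> : << FMonom (i :: s) >> = << fmu i >> * << FMonom s >> :> free_alg K.
  by rewrite malgM_def fgmulUU mulr1 /mmul /= fmmulE fmuE.
rewrite rmorphM; apply: QM => //.
by have := Qg i.1 i.2; rewrite leavitt_genE /free_gen -lock -surjective_pairing.
Qed.

Definition lact (x : L) (v : nat -> K) : nat -> K := free_act (of_quot x) v.

(** The ideal acts as zero, so the chosen representative does not matter. *)
Lemma lact_quot x v : lact (to_quot _ x) v = free_act x v.
Proof.
apply/funext => n; apply: subr0_eq; rewrite -free_actB.
apply: leavitt_ideal_act.
exact: (of_to_quot (ProperTwoSidedIdeal (leavitt_ideal_two_sided K)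
  (@leavitt_ideal1 K)) x).
Qed.

Lemma lactM x y v : lact (x * y) v = lact x (lact y v).
Proof.
rewrite -[x]of_quotK -[y]of_quotK -rmorphM !lact_quot.
by apply/funext => n; rewrite free_actM.
Qed.

Lemma lactD x y v n : lact (x + y) v n = lact x v n + lact y v n.
Proof.
by rewrite -[x]of_quotK -[y]of_quotK -raddfD !lact_quot free_actD.
Qed.

Lemma lactZ c x v n : lact (c *: x) v n = c * lact x v n.
Proof.
rewrite -[x]of_quotK -to_quot_scalable !lact_quot.
have -> : c *: of_quot x = malgC c * of_quot x :> free_alg K by rewrite mul_malgC.
by rewrite free_actM /free_act [LHS]malg_actU word_act1.
Qed.

Lemma lact1 v : lact 1 v = v.
Proof. by rewrite -(rmorph1 (to_quot _)) lact_quot; apply/funext => n;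
  rewrite free_act1. Qed.

Lemma lact_gen b s v : lact (leavitt_gen K b s) v = gen_act (b, s) v.
Proof. by rewrite leavitt_genE lact_quot free_act_gen. Qed.

(** Letters only move entries or insert zeros, so the new entries are combinations of those of [v]
    with the coefficients of [x]. *)
Lemma free_act_sub (T : K -> Prop) (x : free_alg K) v :
    T 0 -> (forall a b, T a -> T b -> T (a + b)) ->
    (forall a b, T a -> T b -> T (a * b)) ->
    (forall k, k \in msupp x -> T x@_k) ->
  (forall n, T (v n)) -> forall n, T (free_act x v n).
Proof.
move=> T0 TD TM Tx Tv n; rewrite /free_act malg_actE big_seq.
apply: big_ind => // w wx; apply: TM; first exact: Tx.
rewrite /word_act; elim: (fmonom_val w) n => [|i s IHs] n //=.
by rewrite /gen_act; case: i.2; [|case: ifP].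
Qed.

End LeavittAction.

(** * Finite generation of the unit group *)

Section Units.
Variable K : fieldType.
Local Notation L := (leavitt_alg K).
Local Notation E := (leavitt_gen K false false).
Local Notation E' := (leavitt_gen K false true).
Local Notation F := (leavitt_gen K true false).
Local Notation F' := (leavitt_gen K true true).

Lemma leavitt_alg_ind (Q : L -> Prop) :
  (forall c : K, Q c%:A) -> Q E -> Q F -> Q E' -> Q F' ->
  (forall x y, Q x -> Q y -> Q (x + y)) ->
  (forall x y, Q x -> Q y -> Q (x * y)) -> forall x, Q x.
Proof. by move=> Qc QE QF QE' QF'; apply: leavitt_ind => // -[] []. Qed.

Lemma leavitt_unit_elem (x : L) : x \is a GRing.unit -> elem E F E' F' x.
Proof.
move=> /unitrP[y [yx xy]].
(* The integer 1 is the root of the binary tree with children [2n] and [2n+1]; the indicator of 0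
   would be fixed by [e]. *)
pose rho (z : L) := lact z (fun k => (k == 1)%:R).
apply: (@unit_elem K L E F E' F' (leavitt_e'e K) (leavitt_f'f K) (leavitt_e'f K)
  (leavitt_f'e K) (leavitt_sum K) leavitt_alg_ind rho _ _ _ _ x y) => //.
- by move=> c z t n; rewrite /rho lactD lactZ.
- by move=> n; rewrite /rho lact1.
- move=> z n; rewrite /rho lactM lact_gen /gen_act /=.
  by case: (odd n).
- move=> z n; rewrite /rho lactM lact_gen /gen_act /=.
  by case: (odd n).
Qed.

Lemma generated_subgroupP (G : groupType) (A : set G) :
  is_subgroup (generated_subgroup A).
Proof.
split=> [H [] [] //|x y Ax Ay H HP].
by case: (HP) => -[_ HM] _; apply: HM; [apply: Ax|apply: Ay].
Qed.

Lemma sub_generated_subgroup (G : groupType) (A : set G) :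
  A `<=` generated_subgroup A.
Proof. by move=> x Ax H [_]; apply. Qed.

Lemma generated_subgroupM (G : groupType) (A : set G) x y :
  generated_subgroup A x -> generated_subgroup A y ->
  generated_subgroup A (x * y)%g.
Proof.
have [A1 AM] := generated_subgroupP A => Ax Ay.
have AVy : generated_subgroup A (y^-1)%g by rewrite -[(y^-1)%g]mul1g; apply: AM.
by rewrite -[y]invgK; apply: AM.
Qed.

Definition elem_generators : set (unit_group L) :=
  [set u | exists i j g, [/\ i != j, alg_generator E F E' F' g &
     val u = 1 + base E F i * g * cobase E' F' j]].

Lemma elem_generated x : elem E F E' F' x ->
  exists2 u, generated_subgroup elem_generators u & val u = x.
Proof.
elim=> [|y z _ [u Au <-] _ [v Av <-]|i j g ij gP].
- by exists 1%g => //; case: (generated_subgroupP elem_generators).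
- by exists (u * v)%g => //; apply: generated_subgroupM.
have [y _ [xy yx]] := elem_inv (leavitt_e'e K) (leavitt_f'f K) (leavitt_e'f K)
  (leavitt_f'e K) leavitt_alg_ind (ElemGen ij gP).
have xU : 1 + base E F i * g * cobase E' F' j \is a GRing.unit.
  by apply/unitrP; exists y.
by exists (UnitGroup xU) => //; apply: sub_generated_subgroup; exists i, j, g.
Qed.

Lemma finite_elem_generators : finite_set [set: K] -> finite_set elem_generators.
Proof.
move=> finK.
(* Generators are indexed by [K] times a finite type, with [None] standing for the scalars. *)
pose gen (p : K * option (bool * bool)) : L :=
  if p.2 is Some q then p.1 *: leavitt_gen K q.1 q.2 else p.1%:A.
pose mk (p : (K * option (bool * bool)) * ((bool * bool) * (bool * bool))) : L :=
  1 + base E F p.2.1 * gen p.1 * cobase E' F' p.2.2.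
apply: (@sub_finite_set _ _ (val @^-1` (mk @` [set: _]))).
  move=> u [i [j [g [_ gP uE]]]]; have [p pE] : exists p, gen p = g.
    case: gP => [c|c b|c b]; first by exists (c, None).
      by exists (c, Some (b, false)); case: b.
    by exists (c, Some (b, true)); case: b.
  by exists (p, (i, j)) => //; rewrite uE /mk pE.
apply: finite_preimage; first by move=> u v _ _; apply: val_inj.
apply: finite_image; rewrite -setXTT; apply: finite_setX;
  last exact: finite_finset.
by rewrite -setXTT; apply: finite_setX => //; apply: finite_finset.
Qed.

Lemma finite_field_fg : finite_set [set: K] -> finitely_generated (unit_group L).
Proof.
move=> finK; exists elem_generators; split; first exact: finite_elem_generators.
rewrite -subTset => u _.
have [v Av /val_inj <-] := elem_generated (leavitt_unit_elem (valP u)).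
exact: Av.
Qed.

Lemma fg_finite_field : finitely_generated (unit_group L) -> finite_set [set: K].
Proof.
move=> [A [/finite_seqP[s ->] genA]].
pose coefs (x : L) : seq K := [seq (of_quot x)@_k | k <- msupp (of_quot x)].
pose ucoefs (u : unit_group L) := coefs (val u) ++ coefs (val (u^-1)%g).
pose xs := flatten (map ucoefs s).
apply: (@fg_field_finite K xs).
move=> T T1 TB TM Ts.
have T0 : T 0 by rewrite -(subrr 1); apply: TB.
have TD a b : T a -> T b -> T (a + b).
  by move=> Ta Tb; rewrite -[b]opprK; apply: (TB) => //; rewrite -sub0r;
    apply: TB.
pose stab (x : L) := forall v, (forall n, T (v n)) -> forall n, T (lact x v n).
have stab_coefs x : (forall c, c \in coefs x -> T c) -> stab x.
  move=> Tc v Tv; apply: free_act_sub => // k kx; apply: Tc.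
  exact: (map_f (fun k => (of_quot x)@_k)).
have stabM x y : stab x -> stab y -> stab (x * y).
  by move=> Sx Sy v Tv; rewrite lactM; apply: Sx; apply: Sy.
(* Requiring the inverse to preserve [T] as well makes the property define a subgroup. *)
have stabU (u : unit_group L) : stab (val u) /\ stab (val (u^-1)%g).
  have : generated_subgroup [set` s] u by rewrite genA.
  move=> /(_ [set u : unit_group L | stab (val u) /\ stab (val (u^-1)%g)]);
    apply; split; [split|].
  - have V1 : (1^-1 = 1 :> unit_group L)%g := invg1 _.
    by split; rewrite ?V1 => v Tv n; rewrite lact1.
  - move=> x y [Sx SVx] [Sy SVy].
    have xyV : ((x * y^-1)^-1 = y * x^-1 :> unit_group L)%g
      by rewrite invgM invgK.
    by split; rewrite ?xyV; apply: stabM.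
  move=> x /= sx; split; apply: stab_coefs => c cx; apply: Ts;
    apply/flattenP; exists (ucoefs x); by rewrite ?map_f // mem_cat cx ?orbT.
move=> c; have [->//|c0] := eqVneq c 0.
have cU : (c%:A : L) \is a GRing.unit by rewrite scaler_unit ?unitr1 ?unitfE.
(* The scalar [c] sends the constant sequence 1 to the constant sequence [c]. *)
have [/(_ (fun=> 1) (fun=> T1) 0%N) + _] := stabU (UnitGroup cU).
by rewrite /= lactZ lact1 mulr1.
Qed.

End Units.

Theorem theorem5p3 (K : fieldType) :
  finitely_generated (unit_group (leavitt_alg K)) <-> finite_set [set: K].
Proof. by split; [exact: fg_finite_field|exact: finite_field_fg]. Qed.
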